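(* Let $(H,R)$ be a finite dimensional quasi-triangular quasi-Hopf algebra, let $t$ be a non-zero left integral in $H$ and let $\mu$ be the distinguished group-like element of $H^*$. 1) Let $q_R=q^1\otimes q^2=Q^1\otimes Q^2$ (two copies) and $p_R=p^1\otimes p^2=P^1\otimes P^2$ (two copies). Then $$\mu(Q^1)\,q^2t_2p^2\,S\big(Q^2(R^2P^2\leftharpoonup\mu)\big)R^1P^1\otimes q^1t_1p^1=S(u)q^1t_1p^1\otimes q^2t_2p^2,$$ where $R=R^1\otimes R^2$, $u=S(R^2p^2)\alpha R^1p^1$, and $h\leftharpoonup\mu=\mu(h_1)h_2$ for $h\in H$. 2) If $(H,R)$ is factorizable then $H$ is unimodular.
   Context: All vector spaces and tensor products are over a fixed field $k$. **Quasi-Hopf algebras.** A quasi-bialgebra $(H,\Delta,\varepsilon,\Phi)$ is a unital associative algebra $H$ with an invertible $\Phi\in H^{\otimes 3}$ and algebra maps $\Delta:H\to H\otimes H$, $\varepsilon:H\to k$ such that $(id\otimes\Delta)(\Delta(h))=\Phi(\Delta\otimes id)(\Delta(h))\Phi^{-1}$, $(id\otimes\varepsilon)\Delta(h)=h=(\varepsilon\otimes id)\Delta(h)$, $(1\otimes\Phi)(id\otimes\Delta\otimes id)(\Phi)(\Phi\otimes 1)=(id\otimes id\otimes\Delta)(\Phi)(\Delta\otimes id\otimes id)(\Phi)$, $(id\otimes\varepsilon\otimes id)(\Phi)=1\otimes 1$. Write (summation understood) $\Delta(h)=h_1\otimes h_2$; $\Phi=X^1\otimes X^2\otimes X^3=\cdots$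 and $\Phi^{-1}=x^1\otimes x^2\otimes x^3=\cdots$ (different letters denote independent copies; e.g. $X^2_1\otimes X^2_2=\Delta(X^2)$). It is a quasi-Hopf algebra if there are an algebra anti-endomorphism $S$ of $H$ and $\alpha,\beta\in H$ with $S(h_1)\alpha h_2=\varepsilon(h)\alpha$, $h_1\beta S(h_2)=\varepsilon(h)\beta$, $X^1\beta S(X^2)\alpha X^3=1$, $S(x^1)\alpha x^2\beta S(x^3)=1$; normalized so that $\varepsilon(\alpha)=\varepsilon(\beta)=1$. $S$ is automatically bijective if $H$ is finite dimensional or quasi-triangular. **Special elements.** Put $A^1\otimes\cdots\otimes A^4=(\Phi\otimes1)(\Delta\otimes id\otimes id)(\Phi^{-1})$, $B^1\otimes\cdots\otimes B^4=(\Delta\otimes id\otimes id)(\Phi)(\Phi^{-1}\otimes 1)$, $\gamma=S(A^2)\alpha A^3\otimes S(A^1)\alpha A^4$, $\delta=B^1\beta S(B^4)\otimes B^2\beta S(B^3)$. With $\Delta^{op}(h)=h_2\otimes h_1$, the Drinfeld twist is $f=f^1\otimes f^2=(S\otimes S)(\Delta^{op}(x^1))\,\gamma\,\Delta(x^2\beta S(x^3))$, with inverse $f^{-1}=g^1\otimes g^2=\Delta(S(x^1)\alpha x^2)\,\delta\,(S\otimes S)(\Delta^{op}(x^3))$. Further $p_R=p^1\otimes p^2=x^1\otimes x^2\beta S(x^3)$, $q_R=q^1\otimes q^2=X^1\otimes S^{-1}(\alpha X^3)X^2$, $p_L=\tilde p^1\otimes\tilde p^2=X^2S^{-1}(X^1\beta)\otimes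 X^3$, and $U=U^1\otimes U^2=g^1S(q^2)\otimes g^2S(q^1)$. **Quasi-triangular (QT).** $(H,R)$ is QT if $R=R^1\otimes R^2\in H\otimes H$ satisfies $(\Delta\otimes id)(R)=\Phi_{312}R_{13}\Phi^{-1}_{132}R_{23}\Phi$, $(id\otimes\Delta)(R)=\Phi^{-1}_{231}R_{13}\Phi_{213}R_{12}\Phi^{-1}$, $\Delta^{op}(h)R=R\Delta(h)$, $(\varepsilon\otimes id)(R)=(id\otimes\varepsilon)(R)=1$, where $\Phi_{\sigma(1)\sigma(2)\sigma(3)}=X^{\sigma^{-1}(1)}\otimes X^{\sigma^{-1}(2)}\otimes X^{\sigma^{-1}(3)}$ and $R_{ij}$ is $R$ in the $i$-th and $j$-th positions. **Factorizable.** A QT quasi-Hopf algebra $(H,R)$ is factorizable if the $k$-linear map $\mathcal Q:H^*\to H$, $\mathcal Q(\chi)=\langle\chi,\,S(X^2_2\tilde p^2)f^1R^2r^1U^1X^3\rangle\,X^1S(X^2_1\tilde p^1)f^2R^1r^2U^2$, is bijective, where $r^1\otimes r^2$ is another copy of $R$. **Integrals.** $t\in H$ is a left (right) integral if $ht=\varepsilon(h)t$ (resp. $th=\varepsilon(h)t$) for all $h\in H$. For $H$ finite dimensional the spaces of left and of right integrals are one dimensional. $H$ is unimodular if there is a non-zero left integral that is also a right integral. The distinguished group-like element $\mu\in H^*$ is the algebra map $\mu:H\to k$ with $th=\mu(h)t$ for every left integral $t$ and $h\in H$. *)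

(* Defs.v *)
From HB Require Import structures.
From mathcomp Require Import all_boot all_order all_algebra all_field.

Set Implicit Arguments.
Unset Strict Implicit.
Unset Printing Implicit Defensive.

Import GRing.Theory.
Local Open Scope ring_scope.

(* \ox binds more loosely than products and scaling, more tightly than sums;  *)
(* it associates to the left, H^{\ox 3} being (H \ox H) \ox H.                *)
Reserved Notation "u \ox v" (at level 45, left associativity).
Reserved Notation "\tsum_ ( a , b <- t ) E"
  (at level 46, a name, b name, t at level 200, E at level 46).
Reserved Notation "\tsum_ ( a , b , c <- t ) E"
  (at level 46, a name, b name, c name, t at level 200, E at level 46).
Reserved Notation "\tsum_ ( a , b , c , d <- t ) E"
  (at level 46, a name, b name, c name, d name, t at level 200, E at level 46).

(* The tensor product of two finite dimensional spaces, modelled as the space *)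
(* of coordinate matrices with respect to the bases vbasis {:U}, vbasis {:V}. *)
(* Lemmas tsum_ox and tensorE give its universal property, so that the choice *)
(* of bases is immaterial.                                                    *)
Section Tensor.

Variables (K : fieldType) (U V : vectType K).

Definition tensor : Type := 'M[K]_(\dim {:U}, \dim {:V}).

HB.instance Definition _ := Vector.on tensor.

Definition tpure (u : U) (v : V) : tensor :=
  \matrix_(i, j) (coord (vbasis {:U}) i u * coord (vbasis {:V}) j v).

(* Sweedler summation: tsum F t is the value at t of the linear map           *)
(* tensor -> W induced by a map F which is (in all uses) bilinear.            *)
Definition tsum (W : lmodType K) (F : U -> V -> W) (t : tensor) : W :=
  \sum_i \sum_j (t : 'M_(_, _)) i j *: F (vbasis {:U})`_i (vbasis {:V})`_j.

End Tensor.

Notation "u \ox v" := (tpure u v) : ring_scope.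
Notation "\tsum_ ( a , b <- t ) E" := (tsum (fun a b => E) t) : ring_scope.
Notation "\tsum_ ( a , b , c <- t ) E" :=
  (tsum (fun p c => tsum (fun a b => E) p) t) : ring_scope.
Notation "\tsum_ ( a , b , c , d <- t ) E" :=
  (tsum (fun p d => tsum (fun q c => tsum (fun a b => E) q) p) t) : ring_scope.

Section TensorTheory.

Variables (K : fieldType) (U V : vectType K).

Lemma tsum_is_linear (W : lmodType K) (F : U -> V -> W) : linear (tsum F).
Proof.
move=> a s t; rewrite /tsum scaler_sumr -big_split; apply: eq_bigr => i _ /=.
rewrite scaler_sumr -big_split; apply: eq_bigr => j _ /=.
by rewrite !mxE scalerDl scalerA.
Qed.
HB.instance Definition _ (W : lmodType K) (F : U -> V -> W) :=
  GRing.isLinear.Build K (tensor U V) W _ (tsum F) (tsum_is_linear F).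

Lemma tpure_linearl (v : V) : linear (fun u : U => u \ox v).
Proof.
by move=> a s t; apply/matrixP=> i j; rewrite !mxE linearP mulrDl mulrA.
Qed.

Lemma tpure_linearr (u : U) : linear (fun v : V => u \ox v).
Proof.
by move=> a s t; apply/matrixP=> i j; rewrite !mxE linearP mulrDr mulrCA.
Qed.

Lemma tsum_ox (W : lmodType K) (F : U -> V -> W) (u : U) (v : V) :
  (forall y, linear (F^~ y)) -> (forall x, linear (F x)) ->
  tsum F (u \ox v) = F u v.
Proof.
move=> lFl lFr.
pose Fl y : {linear U -> W} := HB.pack (F^~ y) (GRing.isLinear.Build _ _ _ _ _ (lFl y)).
pose Fr x : {linear V -> W} := HB.pack (F x) (GRing.isLinear.Build _ _ _ _ _ (lFr x)).
rewrite {2}(coord_vbasis (memvf u)) {2}(coord_vbasis (memvf v)) /tsum.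
rewrite -[RHS]/(Fl _ _) linear_sum; apply: eq_bigr => i _.
rewrite linearZ -[X in _ = _ *: X]/(Fr _ _) linear_sum scaler_sumr.
by apply: eq_bigr => j _; rewrite linearZ mxE scalerA.
Qed.

Lemma tsum_ext (W : lmodType K) (F G : U -> V -> W) t :
  F =2 G -> tsum F t = tsum G t.
Proof.
by move=> FG; apply: eq_bigr => i _; apply: eq_bigr => j _; rewrite FG.
Qed.

Lemma tsum_linearF (W : lmodType K) a (F G : U -> V -> W) t :
  tsum (fun u v => a *: F u v + G u v) t = a *: tsum F t + tsum G t.
Proof.
rewrite /tsum scaler_sumr -big_split; apply: eq_bigr => i _ /=.
rewrite scaler_sumr -big_split; apply: eq_bigr => j _ /=.
by rewrite scalerDr !scalerA mulrC.
Qed.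

Lemma tensorE (t : tensor U V) : \tsum_(a, b <- t) a \ox b = t.
Proof.
have fU := basis_free (vbasisP {:U}); have fV := basis_free (vbasisP {:V}).
apply/matrixP=> i j; rewrite /tsum summxE (bigD1 i) //= summxE (bigD1 j) //=.
rewrite !mxE !coord_free // !eqxx !mulr1 !big1 ?addr0 // => [k nk | k nk].
  rewrite summxE big1 // => l _; rewrite !mxE (coord_free k i fU).
  by rewrite (negbTE nk) mul0r mulr0.
rewrite !mxE (coord_free k j fV).
by rewrite (negbTE nk) !mulr0.
Qed.

Lemma tensor_ind (P : tensor U V -> Prop) :
  (forall u v, P (u \ox v)) -> (forall s t, P s -> P t -> P (s + t)) ->
  forall t, P t.
Proof.
move=> Pox PD t; rewrite -(tensorE t).
have P0 : P 0.
  by have := Pox 0 0; congr P; apply/matrixP=> i j; rewrite !mxE linear0 mul0r.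
rewrite /tsum; elim/big_ind: _ => // i _; elim/big_ind: _ => // j _.
have := Pox (t i j *: (vbasis {:U})`_i) (vbasis {:V})`_j; congr P.
by apply/matrixP=> k l; rewrite !mxE linearZ /= mulrA.
Qed.

End TensorTheory.

(* The tensor product algebra, (a \ox b) * (c \ox d) = (a * c) \ox (b * d). *)
Section TensorAlgebra.

Variables (K : fieldType) (A B : falgType K).

Implicit Types s t r : tensor A B.

Definition tmul s t : tensor A B :=
  \tsum_(a, b <- s) \tsum_(c, d <- t) (a * c) \ox (b * d).

Definition tone : tensor A B := 1 \ox 1.

Lemma tmul_linearl t : linear (tmul^~ t).
Proof. exact: tsum_is_linear. Qed.

Lemma tmul_linearr s : linear (tmul s).
Proof.
move=> a t r; rewrite /tmul -tsum_linearF; apply: tsum_ext => b c.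
exact: tsum_is_linear.
Qed.

Lemma tmul_ox (a c : A) (b d : B) :
  tmul (a \ox b) (c \ox d) = (a * c) \ox (b * d).
Proof.
rewrite /tmul tsum_ox => [|y x u v|x y u v].
- rewrite tsum_ox // => [y x u v|x y u v].
    by rewrite mulrDr -scalerAr (tpure_linearl (b * y)).
  by rewrite mulrDr -scalerAr (tpure_linearr (a * x)).
- rewrite -tsum_linearF; apply: tsum_ext => p q.
  by rewrite mulrDl -scalerAl (tpure_linearl (y * q)).
- rewrite -tsum_linearF; apply: tsum_ext => p q.
  by rewrite mulrDl -scalerAl (tpure_linearr (x * p)).
Qed.

Lemma tmulDl : left_distributive tmul +%R.
Proof. by move=> s t r; have := tmul_linearl r 1 s t; rewrite !scale1r. Qed.

Lemma tmulDr : right_distributive tmul +%R.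
Proof. by move=> r s t; have := tmul_linearr r 1 s t; rewrite !scale1r. Qed.

Lemma tmulA : associative tmul.
Proof.
move=> s t r; elim/tensor_ind: s => [a b|s s' IH IH']; last first.
  by rewrite !tmulDl IH IH'.
elim/tensor_ind: t => [c d|t t' IH IH']; last by rewrite !(tmulDl, tmulDr) IH IH'.
elim/tensor_ind: r => [e g|r r' IH IH']; last by rewrite !tmulDr IH IH'.
by rewrite !tmul_ox !mulrA.
Qed.

Lemma tmul1r : left_id tone tmul.
Proof.
elim/tensor_ind=> [a b|s t IHs IHt]; last by rewrite tmulDr IHs IHt.
by rewrite tmul_ox !mul1r.
Qed.

Lemma tmulr1 : right_id tone tmul.
Proof.
elim/tensor_ind=> [a b|s t IHs IHt]; last by rewrite tmulDl IHs IHt.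
by rewrite tmul_ox !mulr1.
Qed.

Lemma tone_neq0 : tone != 0.
Proof.
have coord1 (C : falgType K) : exists i, coord (vbasis {:C}) i 1 != 0.
  apply/existsP; apply: contraNT (oner_neq0 C); rewrite negb_exists => /forallP c0.
  rewrite (coord_vbasis (memvf 1)) big1 // => i _.
  by have /negPn/eqP-> := c0 i; rewrite scale0r.
have [i ai] := coord1 A; have [j bj] := coord1 B.
apply/eqP=> /matrixP/(_ i j); rewrite !mxE => /eqP.
by rewrite mulf_eq0 (negbTE ai) (negbTE bj).
Qed.

HB.instance Definition _ := GRing.Zmodule_isNzRing.Build (tensor A B)
  tmulA tmul1r tmulr1 tmulDl tmulDr tone_neq0.

Lemma tscalerAl (a : K) s t : a *: (s * t) = a *: s * t.
Proof.
by have := tmul_linearl t a s 0; rewrite /= -[tmul 0 t]/(0 * t) mul0r !addr0.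
Qed.

HB.instance Definition _ := GRing.Lmodule_isLalgebra.Build K (tensor A B) tscalerAl.

Lemma tscalerAr (a : K) s t : a *: (s * t) = s * (a *: t).
Proof.
by have := tmul_linearr s a t 0; rewrite -[tmul s 0]/(s * 0) mulr0 !addr0.
Qed.

HB.instance Definition _ := GRing.Lalgebra_isAlgebra.Build K (tensor A B) tscalerAr.
HB.instance Definition _ := Algebra_isFalgebra.Build K (tensor A B).

End TensorAlgebra.

Section CoproductLegs.

Variables (K : fieldType) (H : falgType K) (Delta : H -> tensor H H).

Local Notation H2 := (tensor H H).
Local Notation H3 := (tensor H2 H).
Local Notation H4 := (tensor H3 H).

Definition cop_id (t : H2) : H3 := \tsum_(a, b <- t) Delta a \ox b.

Definition id_cop (t : H2) : H3 :=
  \tsum_(a, b <- t) \tsum_(b1, b2 <- Delta b) a \ox b1 \ox b2.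

Definition cop_id_id (t : H3) : H4 :=
  \tsum_(a, b, c <- t) Delta a \ox b \ox c.

Definition id_cop_id (t : H3) : H4 :=
  \tsum_(a, b, c <- t) \tsum_(b1, b2 <- Delta b) a \ox b1 \ox b2 \ox c.

Definition id_id_cop (t : H3) : H4 :=
  \tsum_(a, b, c <- t) \tsum_(c1, c2 <- Delta c) a \ox b \ox c1 \ox c2.

End CoproductLegs.

(* H \ox k and k \ox H are identified with H through scaling.                 *)
Record quasiBialgebra (K : fieldType) (H : falgType K) := QuasiBialgebra {
  cop : {lrmorphism H -> tensor H H};
  counit : {lrmorphism H -> K | *%R};
  assoc : tensor (tensor H H) H;
  assoc_unit : assoc \is a GRing.unit;
  quasi_coassoc : forall h : H,
    id_cop cop (cop h) = assoc * cop_id cop (cop h) * assoc^-1;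
  counit_r : forall h : H, \tsum_(h1, h2 <- cop h) counit h2 *: h1 = h;
  counit_l : forall h : H, \tsum_(h1, h2 <- cop h) counit h1 *: h2 = h;
  pentagon :
    (\tsum_(X1, X2, X3 <- assoc) (1 : H) \ox X1 \ox X2 \ox X3)
      * id_cop_id cop assoc * (assoc \ox (1 : H))
    = id_id_cop cop assoc * cop_id_id cop assoc;
  counit_assoc :
    \tsum_(X1, X2, X3 <- assoc) counit X2 *: (X1 \ox X3) = (1 : H) \ox (1 : H)
}.

Record quasiHopf (K : fieldType) (H : falgType K) := QuasiHopf {
  qbialg :> quasiBialgebra H;
  antipode : {linear H -> H};
  qalpha : H;
  qbeta : H;
  antipode1 : antipode 1 = 1;
  antipodeM : forall a b : H, antipode (a * b) = antipode b * antipode a;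
  antipode_alpha : forall h : H,
    \tsum_(h1, h2 <- cop qbialg h) antipode h1 * qalpha * h2
    = counit qbialg h *: qalpha;
  antipode_beta : forall h : H,
    \tsum_(h1, h2 <- cop qbialg h) h1 * qbeta * antipode h2
    = counit qbialg h *: qbeta;
  antipode_assoc :
    \tsum_(X1, X2, X3 <- assoc qbialg)
      X1 * qbeta * antipode X2 * qalpha * X3 = 1;
  antipode_assocV :
    \tsum_(x1, x2, x3 <- (assoc qbialg)^-1)
      antipode x1 * qalpha * x2 * qbeta * antipode x3 = 1;
  counit_alpha : counit qbialg qalpha = 1;
  counit_beta : counit qbialg qbeta = 1
}.

Section SpecialElements.

Variables (K : fieldType) (H : falgType K) (Q : quasiHopf H).

Local Notation H2 := (tensor H H).
Local Notation H3 := (tensor H2 H).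
Local Notation H4 := (tensor H3 H).
Local Notation Delta := (cop Q).
Local Notation eps := (counit Q).
Local Notation Phi := (assoc Q).
Local Notation S := (antipode Q).
Local Notation alpha := (qalpha Q).
Local Notation beta := (qbeta Q).

(* The inverse as a linear map. Bijectivity of the antipode is not assumed:   *)
(* it is automatic since H is finite dimensional.                             *)
Definition antipodeV : 'End(H) := (linfun S)^-1%VF.
Local Notation Sinv := antipodeV.

(* (S \ox S)(Delta^op(h))                                                     *)
Definition SS_cop_op (h : H) : H2 := \tsum_(h1, h2 <- Delta h) S h2 \ox S h1.

Definition elt_A : H4 := (Phi \ox (1 : H)) * cop_id_id Delta Phi^-1.

Definition elt_B : H4 := cop_id_id Delta Phi * (Phi^-1 \ox (1 : H)).

Definition elt_gamma : H2 :=
  \tsum_(A1, A2, A3, A4 <- elt_A) S A2 * alpha * A3 \ox S A1 * alpha * A4.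

Definition elt_delta : H2 :=
  \tsum_(B1, B2, B3, B4 <- elt_B) B1 * beta * S B4 \ox B2 * beta * S B3.

Definition twist : H2 :=
  \tsum_(x1, x2, x3 <- Phi^-1)
    SS_cop_op x1 * elt_gamma * Delta (x2 * beta * S x3).

Definition twistV : H2 :=
  \tsum_(x1, x2, x3 <- Phi^-1)
    Delta (S x1 * alpha * x2) * elt_delta * SS_cop_op x3.

Definition elt_pR : H2 :=
  \tsum_(x1, x2, x3 <- Phi^-1) x1 \ox x2 * beta * S x3.

Definition elt_qR : H2 :=
  \tsum_(X1, X2, X3 <- Phi) X1 \ox Sinv (alpha * X3) * X2.

Definition elt_pL : H2 :=
  \tsum_(X1, X2, X3 <- Phi) X2 * Sinv (X1 * beta) \ox X3.

Definition elt_U : H2 :=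
  \tsum_(g1, g2 <- twistV) \tsum_(q1, q2 <- elt_qR) g1 * S q2 \ox g2 * S q1.

(* With i, j, k = 3, 1, 2 etc. as in Phi_{ijk}: the n-th component of t is    *)
(* placed in the n-th of the positions i, j, k.                               *)
Definition perm312 (t : H3) : H3 := \tsum_(X1, X2, X3 <- t) X2 \ox X3 \ox X1.
Definition perm132 (t : H3) : H3 := \tsum_(X1, X2, X3 <- t) X1 \ox X3 \ox X2.
Definition perm231 (t : H3) : H3 := \tsum_(X1, X2, X3 <- t) X3 \ox X1 \ox X2.
Definition perm213 (t : H3) : H3 := \tsum_(X1, X2, X3 <- t) X2 \ox X1 \ox X3.

Definition leg12 (r : H2) : H3 := r \ox (1 : H).
Definition leg13 (r : H2) : H3 := \tsum_(r1, r2 <- r) r1 \ox (1 : H) \ox r2.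
Definition leg23 (r : H2) : H3 := \tsum_(r1, r2 <- r) (1 : H) \ox r1 \ox r2.

Record quasitriangular (R : H2) : Prop := Quasitriangular {
  qt_cop_id : cop_id Delta R =
    perm312 Phi * leg13 R * perm132 Phi^-1 * leg23 R * Phi;
  qt_id_cop : id_cop Delta R =
    perm231 Phi^-1 * leg13 R * perm213 Phi * leg12 R * Phi^-1;
  qt_cop_op : forall h : H,
    (\tsum_(h1, h2 <- Delta h) h2 \ox h1) * R = R * Delta h;
  qt_counit_l : \tsum_(R1, R2 <- R) eps R1 *: R2 = 1;
  qt_counit_r : \tsum_(R1, R2 <- R) eps R2 *: R1 = 1
}.

Definition elt_u (R : H2) : H :=
  \tsum_(R1, R2 <- R) \tsum_(p1, p2 <- elt_pR) S (R2 * p2) * alpha * R1 * p1.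

Definition factor_map (R : H2) (chi : 'Hom(H, K^o)) : H :=
  \tsum_(X1, X2, X3 <- Phi) \tsum_(X21, X22 <- Delta X2)
  \tsum_(p1, p2 <- elt_pL) \tsum_(f1, f2 <- twist)
  \tsum_(R1, R2 <- R) \tsum_(r1, r2 <- R) \tsum_(U1, U2 <- elt_U)
    chi (S (X22 * p2) * f1 * R2 * r1 * U1 * X3)
      *: (X1 * S (X21 * p1) * f2 * R1 * r2 * U2).

Definition factorizable (R : H2) : Prop :=
  quasitriangular R /\ bijective (factor_map R).

Definition left_integral (t : H) : Prop := forall h : H, h * t = eps h *: t.

Definition right_integral (t : H) : Prop := forall h : H, t * h = eps h *: t.

Definition unimodular : Prop :=
  exists t : H, [/\ t != 0, left_integral t & right_integral t].

Definition distinguished_grouplike (mu : {lrmorphism H -> K | *%R}) : Prop :=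
  forall t h : H, left_integral t -> t * h = mu h *: t.

(* h <- mu = mu(h_1) h_2                                                      *)
Definition ract (h : H) (mu : H -> K) : H :=
  \tsum_(h1, h2 <- Delta h) mu h1 *: h2.

End SpecialElements.

(* Main.v *)
Require Import Defs.
From HB Require Import structures.
From mathcomp Require Import all_boot all_order all_algebra all_field.
Set Implicit Arguments.
Unset Strict Implicit.
Unset Printing Implicit Defensive.
Import GRing.Theory.
Local Open Scope ring_scope.

(** Everything reduces to a few identities between elements of the tensor powers
    of H.

    First part.  Write q_R = q1 \ox q2, p_R = p1 \ox p2, and let t be a left
    integral.  Because ht = eps(h)t and th = mu(h)t, the intertwining relations
    of q_R and p_R with the coproduct turn one-sided multiplications into each
    other (integral_qR, integral_pR):
      h q1 t1 \ox q2 t2 = q1 t1 \ox S^-1(h) q2 t2,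
      t1 p1 h \ox t2 p2 = t1 p1 \ox t2 p2 S(h <- mu),
    and the elements q_R, p_R can be cancelled again (cop_integral_qR,
    cop_integral_pR).  Applying this to Delta^op(t) R = R Delta(t), the right
    hand action of R gives one side of the claim, and the left hand action gives
    q2 R1 beta S(q1 R2), which is S(u) by the two hexagons (uR_sqR).

    Second part.  The monodromy C = R_21 R commutes with the image of Delta.
    Evaluating C Delta(t) on the left gives z = u S(u) in the second factor
    (cup_monod), so that Delta(t) C = Delta(t)(1 \ox z), where z is central and
    invertible.  Contracting both sides of this with the antipode after one more
    coproduct, and expanding (Delta \ox id)(C) by the hexagons, yields that
    (mu \ox id)(C) = 1 (monodm_eq1): the distinguished character has trivial
    double braiding with everything.  For any character chi with this property
    the two copies of R drop out of the map Q; then the Drinfeld twist meets its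
    inverse (twistT_twistVT) and the pentagon leaves Q(chi) = chi(alpha) beta
    (factorm_char).  The same holds for eps, so that injectivity of Q forces
    mu = mu(alpha) eps, that is mu = eps, and then t is a two-sided integral.

    Bijectivity of S, needed for q_R, comes from the Drinfeld element: u is
    invertible by one hexagon (vR_uR), and u h = S^2(h) u.

    Calculations are carried out by multilinearity.  Both sides of an identity
    are linear in every tensor that occurs, hence it is enough to prove it for
    pure tensors, where it becomes an equality of words in H; what remains are
    the applications of the axioms. *)

(** * Linear maps and pure tensors *)

Reserved Notation "u \x v" (at level 45, left associativity).
Reserved Notation "\ts_ ( a , b <- t ) E"
  (at level 46, a name, b name, t at level 200, E at level 46).
Reserved Notation "\ts_ ( a , b , c <- t ) E"
  (at level 46, a name, b name, c name, t at level 200, E at level 46).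
Reserved Notation "\ts_ ( a , b , c , d <- t ) E"
  (at level 46, a name, b name, c name, d name, t at level 200, E at level 46).

(** Tensor products of algebras only, so that every space has one and the same
    kind of structure and all its operations are found along a single path. *)
Definition tens (K : fieldType) (A B : falgType K) : falgType K := tensor A B.
Definition ox (K : fieldType) (A B : falgType K) (a : A) (b : B) : tens A B := tpure a b.
Definition ts (K : fieldType) (A B W : falgType K) (F : A -> B -> W) (t : tens A B) : W :=
  tsum F t.

(** Unbundled, because it is established for expressions with a hole. *)
Definition islin (K : fieldType) (U W : falgType K) (f : U -> W) : Prop :=
  forall a x y, f (a *: x + y) = a *: f x + f y.
Definition isscal (K : fieldType) (U : falgType K) (f : U -> K) : Prop :=
  forall a x y, f (a *: x + y) = a * f x + f y.

Notation "u \x v" := (ox u v) : ring_scope.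
Notation "\ts_ ( a , b <- t ) E" := (ts (fun a b => E) t) : ring_scope.
Notation "\ts_ ( a , b , c <- t ) E" :=
  (ts (fun p c => ts (fun a b => E) p) t) : ring_scope.
Notation "\ts_ ( a , b , c , d <- t ) E" :=
  (ts (fun p d => ts (fun q c => ts (fun a b => E) q) p) t) : ring_scope.

Section Lin.
Variables (K : fieldType).
Implicit Types (A B U V W X : falgType K).

Lemma lin_id U : islin (fun x : U => x).
Proof. by []. Qed.

Lemma lin_comp U V W (g : V -> W) (f : U -> V) :
  islin g -> islin f -> islin (fun x => g (f x)).
Proof. by move=> hg hf a x y; rewrite hf hg. Qed.

Lemma lin_mull U A (f : U -> A) c : islin f -> islin (fun x => f x * c).
Proof. by move=> hf a x y; rewrite hf mulrDl scalerAl. Qed.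

Lemma lin_mulr U A (f : U -> A) c : islin f -> islin (fun x => c * f x).
Proof. by move=> hf a x y; rewrite hf mulrDr scalerAr. Qed.

Lemma lin_oxl U V W (f : U -> V) (c : W) : islin f -> islin (fun x => f x \x c).
Proof. by move=> hf a x y; rewrite hf; exact: tpure_linearl. Qed.

Lemma lin_oxr U V W (f : U -> W) (c : V) : islin f -> islin (fun x => c \x f x).
Proof. by move=> hf a x y; rewrite hf; exact: tpure_linearr. Qed.

Lemma lin_ts X U V W (F : X -> U -> V -> W) t :
  (forall a b, islin (fun x => F x a b)) -> islin (fun x => ts (F x) t).
Proof.
move=> hF a x y; rewrite /ts -tsum_linearF; apply: tsum_ext => u v; exact: hF.
Qed.

Lemma lin_ts_arg X U V W (F : U -> V -> W) (T : X -> tens U V) :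
  islin T -> islin (fun x => ts F (T x)).
Proof. by move=> hT a x y; rewrite hT; exact: tsum_is_linear. Qed.

Lemma lin_scaler U W (f : U -> W) c : islin f -> islin (fun x => c *: f x).
Proof. by move=> hf a x y; rewrite hf scalerDr !scalerA mulrC. Qed.

Lemma lin_scalel U W (f : U -> K) (c : W) : isscal f -> islin (fun x => f x *: c).
Proof. by move=> hf a x y; rewrite hf scalerDl -scalerA. Qed.

Lemma scal_comp U V (g : V -> K) (f : U -> V) :
  isscal g -> islin f -> isscal (fun x => g (f x)).
Proof. by move=> hg hf a x y; rewrite hf hg. Qed.

Lemma scal_lr U (m : {lrmorphism U -> K | *%R}) : isscal m.
Proof. by move=> a x y; rewrite linearP. Qed.

Lemma ts_ox U V W (F : U -> V -> W) u v :
  (forall y, islin (fun x => F x y)) -> (forall x, islin (fun y => F x y)) ->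
  ts F (u \x v) = F u v.
Proof. exact: tsum_ox. Qed.

Lemma ts_ext U V W (F G : U -> V -> W) t : F =2 G -> ts F t = ts G t.
Proof. exact: tsum_ext. Qed.

Lemma tens_lin_eq U V W (f g : tens U V -> W) :
  islin f -> islin g -> (forall u v, f (u \x v) = g (u \x v)) ->
  forall t, f t = g t.
Proof.
move=> hf hg fg; elim/tensor_ind => // s t fs ft.
by have := hf 1 s t; have := hg 1 s t; rewrite !scale1r => -> ->; rewrite fs ft.
Qed.

Lemma oxM A B (a c : A) (b d : B) : (a \x b) * (c \x d) = (a * c) \x (b * d).
Proof. exact: tmul_ox. Qed.

Lemma one_ox A B : 1 = 1 \x 1 :> tens A B.
Proof. by []. Qed.

Lemma ts_eq0 U V W (F : U -> V -> W) t : (forall a b, F a b = 0) -> ts F t = 0.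
Proof.
by move=> F0; rewrite /ts /tsum big1 // => i _; rewrite big1 // => j _; rewrite F0 scaler0.
Qed.

Lemma ts_one U V W (F : U -> V -> W) : ts F 1 = ts F (1 \x 1).
Proof. by []. Qed.

Lemma ts_scale U V W (F : U -> V -> W) k t : ts F (k *: t) = k *: ts F t.
Proof. exact: linearZ. Qed.

Lemma ox_scalel A B k (u : A) (v : B) : (k *: u) \x v = k *: (u \x v).
Proof. by apply/matrixP => i j; rewrite !mxE linearZ /= mulrA. Qed.
Lemma ox_scaler A B k (u : A) (v : B) : u \x (k *: v) = k *: (u \x v).
Proof. by apply/matrixP => i j; rewrite !mxE linearZ /= mulrCA. Qed.

Lemma islin_ts U V W X (F : U -> V -> W) (G : W -> X) t :
  islin G -> G (ts F t) = \ts_(a, b <- t) G (F a b).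
Proof.
move=> hG; pose g : {linear W -> X} := HB.pack G (GRing.isLinear.Build _ _ _ _ _ hG).
rewrite -[LHS]/(g _) /ts /tsum linear_sum; apply: eq_bigr => i _.
by rewrite linear_sum; apply: eq_bigr => j _; rewrite linearZ.
Qed.
Lemma islinZ W X (G : W -> X) k x : islin G -> G (k *: x) = k *: G x.
Proof.
move=> hG; pose g : {linear W -> X} := HB.pack G (GRing.isLinear.Build _ _ _ _ _ hG).
by rewrite -[LHS]/(g _) linearZ.
Qed.

Lemma ox_inj U V (u : U) (x y : V) : u != 0 -> u \x x = u \x y -> x = y.
Proof.
move=> u0 /matrixP e.
have [i ui] : exists i, coord (vbasis {:U}) i u != 0.
  apply/existsP; apply: contraNT u0; rewrite negb_exists => /forallP c0.
  rewrite (coord_vbasis (memvf u)) big1 // => i _.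
  by have /negPn/eqP-> := c0 i; rewrite scale0r.
rewrite (coord_vbasis (memvf x)) (coord_vbasis (memvf y)); apply: eq_bigr => j _.
by have := e i j; rewrite !mxE => /(mulfI ui) ->.
Qed.
End Lin.

(** * The structure of a quasi-Hopf algebra *)

Section Ops.
Variables (K : fieldType) (H : falgType K) (Q : quasiHopf H).
(** The structure maps as plain functions between algebras, so that linearity and
    multiplicativity are established by the tactics below. *)
Definition copQ (h : H) : tens H H := cop Q h.
Definition antiQ (h : H) : H := antipode Q h.
Definition antiVQ (h : H) : H := antipodeV Q h.
Lemma lin_antiVQ : islin antiVQ. Proof. exact: linearP. Qed.
Lemma antiVQK h : injective antiQ -> antiQ (antiVQ h) = h.
Proof.
move=> inj; have fE x : linfun (antipode Q) x = antiQ x by rewrite lfunE.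
have kf : lker (linfun (antipode Q)) == 0%VS.
  by apply/lker0P => x y; rewrite !fE; apply: inj.
by rewrite -fE /antiVQ /antipodeV lker0_lfunVK.
Qed.
Lemma antiVQZ k a : antiVQ (k *: a) = k *: antiVQ a. Proof. exact: linearZ. Qed.

Definition alphaQ : H := qalpha Q.
Definition betaQ : H := qbeta Q.
Definition epsQ (h : H) : K := counit Q h.
Definition PhiQ : tens (tens H H) H := assoc Q.
Definition PhiVQ : tens (tens H H) H := (assoc Q)^-1.
Lemma lin_copQ : islin copQ. Proof. exact: linearP. Qed.
Lemma lin_antiQ : islin antiQ. Proof. exact: linearP. Qed.
Lemma scal_epsQ : isscal epsQ. Proof. exact: linearP. Qed.
Lemma copQM a b : copQ (a * b) = copQ a * copQ b. Proof. exact: rmorphM. Qed.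
Lemma copQ1 : copQ 1 = 1. Proof. exact: rmorph1. Qed.
Lemma antiQM a b : antiQ (a * b) = antiQ b * antiQ a. Proof. exact: antipodeM. Qed.
Lemma antiQ1 : antiQ 1 = 1. Proof. exact: antipode1. Qed.
Lemma epsQM a b : epsQ (a * b) = epsQ a * epsQ b. Proof. exact: rmorphM. Qed.
Lemma epsQ1 : epsQ 1 = 1. Proof. exact: rmorph1. Qed.
Lemma copQZ k a : copQ (k *: a) = k *: copQ a. Proof. exact: linearZ. Qed.
Lemma antiQZ k a : antiQ (k *: a) = k *: antiQ a. Proof. exact: linearZ. Qed.

Local Notation H2 := (tens H H).
Local Notation H3 := (tens H2 H).
Local Notation H4 := (tens H3 H).

Definition cop1 (t : H2) : H3 := \ts_(a, b <- t) copQ a \x b.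
Definition cop2 (t : H2) : H3 := \ts_(a, b <- t) \ts_(b1, b2 <- copQ b) a \x b1 \x b2.
Definition cop1_4 (t : H3) : H4 := \ts_(a, b, c <- t) copQ a \x b \x c.
Definition cop2_4 (t : H3) : H4 :=
  \ts_(a, b, c <- t) \ts_(b1, b2 <- copQ b) a \x b1 \x b2 \x c.
Definition cop3_4 (t : H3) : H4 :=
  \ts_(a, b, c <- t) \ts_(c1, c2 <- copQ c) a \x b \x c1 \x c2.
Definition ins1 (t : H3) : H4 := \ts_(a, b, c <- t) 1 \x a \x b \x c.

Lemma PhiQK : PhiQ * PhiVQ = 1.
Proof. exact: mulrV (assoc_unit Q). Qed.
Lemma PhiVQK : PhiVQ * PhiQ = 1.
Proof. exact: mulVr (assoc_unit Q). Qed.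
Lemma coassQ h : cop2 (copQ h) * PhiQ = PhiQ * cop1 (copQ h).
Proof. by rewrite -[LHS]/(id_cop (cop Q) (cop Q h) * assoc Q)
  quasi_coassoc mulrVK ?assoc_unit. Qed.
Lemma pentagonQ : ins1 PhiQ * cop2_4 PhiQ * (PhiQ \x 1) = cop3_4 PhiQ * cop1_4 PhiQ.
Proof. exact: pentagon. Qed.
Lemma epsQ_l h : \ts_(h1, h2 <- copQ h) epsQ h1 *: h2 = h.
Proof. exact: counit_l. Qed.
Lemma epsQ_r h : \ts_(h1, h2 <- copQ h) epsQ h2 *: h1 = h.
Proof. exact: counit_r. Qed.
Lemma epsQ_Phi2 : \ts_(a, b, c <- PhiQ) epsQ b *: (a \x c) = 1.
Proof. exact: counit_assoc. Qed.
Lemma antiQ_alpha h : \ts_(h1, h2 <- copQ h) antiQ h1 * alphaQ * h2 = epsQ h *: alphaQ.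
Proof. exact: antipode_alpha. Qed.
Lemma antiQ_beta h : \ts_(h1, h2 <- copQ h) h1 * betaQ * antiQ h2 = epsQ h *: betaQ.
Proof. exact: antipode_beta. Qed.
Lemma antiQ_Phi : \ts_(a, b, c <- PhiQ) a * betaQ * antiQ b * alphaQ * c = 1.
Proof. exact: antipode_assoc. Qed.
Lemma antiQ_PhiV : \ts_(a, b, c <- PhiVQ) antiQ a * alphaQ * b * betaQ * antiQ c = 1.
Proof. exact: antipode_assocV. Qed.

Definition flip (t : H2) : H2 := \ts_(a, b <- t) b \x a.
Definition p312 (t : H3) : H3 := \ts_(a, b, c <- t) b \x c \x a.
Definition p132 (t : H3) : H3 := \ts_(a, b, c <- t) a \x c \x b.
Definition p231 (t : H3) : H3 := \ts_(a, b, c <- t) c \x a \x b.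
Definition p213 (t : H3) : H3 := \ts_(a, b, c <- t) b \x a \x c.
Definition l12 (r : H2) : H3 := r \x 1.
Definition l13 (r : H2) : H3 := \ts_(a, b <- r) a \x 1 \x b.
Definition l23 (r : H2) : H3 := \ts_(a, b <- r) 1 \x a \x b.

Section QT.
Variables (R : H2) (hR : quasitriangular Q R).
Lemma hexagon1 : cop1 R = p312 PhiQ * l13 R * p132 PhiVQ * l23 R * PhiQ.
Proof. exact: qt_cop_id hR. Qed.
Lemma hexagon2 : cop2 R = p231 PhiVQ * l13 R * p213 PhiQ * l12 R * PhiVQ.
Proof. exact: qt_id_cop hR. Qed.
Lemma cop_op_R h : flip (copQ h) * R = R * copQ h.
Proof. exact: qt_cop_op hR h. Qed.
Lemma epsQ_R_l : \ts_(a, b <- R) epsQ a *: b = 1.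
Proof. exact: qt_counit_l hR. Qed.
Lemma epsQ_R_r : \ts_(a, b <- R) epsQ b *: a = 1.
Proof. exact: qt_counit_r hR. Qed.

End QT.

End Ops.
(* Kept folded: the identities below use only the facts stated so far, and
   unification must not descend to the coordinates of a tensor. *)
#[global] Opaque tens ox ts copQ antiQ antiVQ alphaQ betaQ epsQ PhiQ PhiVQ.

(** * Reduction of multilinear identities to pure tensors *)

(** lin proves that an expression is linear in its hole, following its syntax;
    hypotheses are used for maps that are kept abstract. *)
Ltac lin1 := match goal with
  | |- forall _, _ => intro
  | |- islin (fun x => x) => refine (@lin_id _ _)
  | |- islin (fun x => @?f x * ?c) => refine (@lin_mull _ _ _ f c _)
  | |- islin (fun x => ?c * @?f x) => refine (@lin_mulr _ _ _ f c _)
  | |- islin (fun x => @?f x \x ?c) => refine (@lin_oxl _ _ _ _ f c _)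
  | |- islin (fun x => ?c \x @?f x) => refine (@lin_oxr _ _ _ _ f c _)
  | |- islin (fun x => ts (@?F x) ?t) => refine (@lin_ts _ _ _ _ _ F t _); cbv beta
  | |- islin (fun x => ts ?F (@?t x)) => refine (@lin_ts_arg _ _ _ _ _ F t _)
  | |- islin (fun x => ?c *: (@?f x)) => refine (@lin_scaler _ _ _ f c _)
  | |- islin (fun x => (@?f x) *: ?c) => refine (@lin_scalel _ _ _ f c _)
  | |- islin (fun x => copQ ?Q (@?t x)) =>
      refine (@lin_comp _ _ _ _ (copQ Q) t (@lin_copQ _ _ Q) _)
  | |- islin (fun x => antiQ ?Q (@?t x)) =>
      refine (@lin_comp _ _ _ _ (antiQ Q) t (@lin_antiQ _ _ Q) _)
  | |- islin (fun x => antiVQ ?Q (@?t x)) =>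
      refine (@lin_comp _ _ _ _ (antiVQ Q) t (@lin_antiVQ _ _ Q) _)
  | |- islin (fun x => ?g (@?t x)) => refine (@lin_comp _ _ _ _ g t _ _); [assumption|]
  | |- islin ?f => assumption
  | |- islin ?f =>
      lazymatch f with fun _ => _ => fail | _ => change (islin (fun x => f x)) end
  | |- isscal (fun x => epsQ ?Q (@?t x)) =>
      refine (@scal_comp _ _ _ (epsQ Q) t (@scal_epsQ _ _ Q) _)
  | |- isscal (fun x => ?g (@?t x)) => refine (@scal_comp _ _ _ g t _ _); [assumption|]
  end.
Ltac lin := repeat lin1.

(** Replaces the tensor t by a generic pure tensor, after checking that both
    sides of the equation are linear in t.  A tensor that occurs twice on one
    side has to be generalized to two independent ones beforehand. *)
Ltac purify t :=
  lazymatch goal with |- ?L = ?R =>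
    lazymatch (eval pattern t in L) with ?f _ =>
    lazymatch (eval pattern t in R) with ?g _ =>
      refine (@tens_lin_eq _ _ _ _ f g _ _ _ t);
      [solve [lin] | solve [lin]
      | let u := fresh "u" in let v := fresh "v" in intros u v; cbv beta]
    end end end.

(** pures takes all tensors apart, including the coproducts of elements, and
    normalizes both sides to a word in H, up to associativity. *)
Ltac pure1 := match goal with
  | |- context [@ts ?K ?A ?B ?W ?F (@ox ?K1 ?A1 ?B1 ?u ?v)] =>
      pattern (@ts K A B W F (@ox K1 A1 B1 u v));
      match goal with |- ?P _ =>
        refine (@eq_ind_r _ _ P _ _ (@ts_ox K A B W F u v _ _));
        [cbv beta | solve [lin] | solve [lin]] end
  | |- context [(?a \x ?b) * (?c \x ?d)] => rewrite (oxM a b c d) || rewrite oxM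
  | |- context [?a * 1] => rewrite (mulr1 a)
  | |- context [1 * ?a] => rewrite (mul1r a)
  | |- context [antiQ ?Q (?a * ?b)] => rewrite (antiQM Q a b)
  | |- context [copQ ?Q (?a * ?b)] => rewrite (copQM Q a b)
  | |- context [epsQ ?Q (?a * ?b)] => rewrite (epsQM Q a b)
  | |- context [antiQ ?Q 1] => rewrite (antiQ1 Q)
  | |- context [copQ ?Q 1] => rewrite (copQ1 Q)
  | |- context [epsQ ?Q 1] => rewrite (epsQ1 Q)
  | |- context [@ts _ _ _ _ ?F 1] => rewrite (@ts_one _ _ _ _ F)
  | |- context [(?k *: ?a) \x ?b] => rewrite (ox_scalel k a b)
  | |- context [?a \x (?k *: ?b)] => rewrite (ox_scaler k a b)
  | |- context [(?k *: ?a) * ?b] => rewrite -(scalerAl k a b)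
  | |- context [?a * (?k *: ?b)] => rewrite -(scalerAr k a b)
  | |- context [antiQ ?Q (?k *: ?b)] => rewrite (antiQZ Q k b)
  | |- context [antiVQ ?Q (?k *: ?b)] => rewrite (antiVQZ Q k b)
  | |- context [copQ ?Q (?k *: ?b)] => rewrite (copQZ Q k b)
  | |- context [ts ?F (?k *: ?b)] => rewrite (ts_scale F k b)
  | t : Falgebra.sort (tens _ _) |- context [?t] => is_var t; purify t
  | |- context [copQ ?Q ?t] => purify (copQ Q t)
  end.
Ltac pures := repeat pure1; rewrite ?scalerA ?mulrA ?mulr1 ?mul1r.

(** For an equation whose left side contains the coproduct of h only through
    S(h1) alpha h2 or h1 beta S(h2): L is the contraction lemma to apply and G the
    expression that surrounds this element. *)
Ltac contract_by L G h :=
  refine (eq_trans (eq_trans _ (L _ G h _)) _); cbv beta; [by pures | by lin | by pures].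

(** * The pentagon and the counits of the associator *)

Section QuasiHopf.

Variables (K : fieldType) (H : falgType K) (Q : quasiHopf H).
Local Notation H2 := (tens H H).
Local Notation H3 := (tens H2 H).
Local Notation H4 := (tens H3 H).
Local Notation Delta := (copQ Q).
Local Notation eps := (epsQ Q).
Local Notation Phi := (PhiQ Q).
Local Notation PhiV := (PhiVQ Q).
Local Notation S := (antiQ Q).
Local Notation alpha := (alphaQ Q).
Local Notation beta := (betaQ Q).
Local Notation Si := (antiVQ Q).

Lemma cop1_4M (s t : H3) : cop1_4 Q (s * t) = cop1_4 Q s * cop1_4 Q t.
Proof. by rewrite /cop1_4; pures. Qed.
Lemma cop2_4M (s t : H3) : cop2_4 Q (s * t) = cop2_4 Q s * cop2_4 Q t.
Proof. by rewrite /cop2_4; pures. Qed.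
Lemma cop3_4M (s t : H3) : cop3_4 Q (s * t) = cop3_4 Q s * cop3_4 Q t.
Proof. by rewrite /cop3_4; pures. Qed.
Lemma ins1M (s t : H3) : ins1 (s * t) = ins1 s * ins1 t.
Proof. by rewrite /ins1; pures. Qed.
Lemma cop1M (s t : H2) : cop1 Q (s * t) = cop1 Q s * cop1 Q t.
Proof. by rewrite /cop1; pures. Qed.
Lemma cop1_4_1 : cop1_4 Q 1 = 1. Proof. by rewrite /cop1_4; pures; rewrite -!one_ox. Qed.
Lemma cop2_4_1 : cop2_4 Q 1 = 1. Proof. by rewrite /cop2_4; pures; rewrite -!one_ox. Qed.
Lemma cop3_4_1 : cop3_4 Q 1 = 1. Proof. by rewrite /cop3_4; pures; rewrite -!one_ox. Qed.
Lemma ins1_1 : ins1 1 = 1 :> H4. Proof. by rewrite /ins1; pures; rewrite -!one_ox. Qed.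

Lemma right_inverse_unit (R : falgType K) (a a' : R) :
  a * a' = 1 -> a' = a^-1 /\ a \is a GRing.unit.
Proof.
move=> e; have ua : a \is a GRing.unit.
  have kf : lker (amull a') == 0%VS.
    by apply/lker0P => x y; rewrite !lfunE /= => /(congr1 (fun z => a * z));
      rewrite !mulrA e !mul1r.
  have /lfunP/(_ 1) := lker0_compfV kf; rewrite comp_lfunE id_lfunE lfunE /=;
    set y := (X in _ * X) => h.
  apply/unitrP; exists a'; split=> //; rewrite -[RHS]h; congr (_ * _).
  by rewrite -[RHS]mul1r -e -mulrA h mulr1.
by split=> //; rewrite -[RHS]mulr1 -e mulKr.
Qed.

(** The rearrangements of the pentagon that are needed, for five invertible
    elements of an algebra. *)
Lemma pentagon_variants (R : falgType K) (A A' B B' C C' D D' E E' : R) :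
  A * A' = 1 -> B * B' = 1 -> C * C' = 1 -> D * D' = 1 -> E * E' = 1 ->
  A * B * C = D * E ->
  [/\ E * C' = D' * A * B, C * E' = B' * A' * D, C' * B' * A' = E' * D'
    & D' * A = E * C' * B'].
Proof.
move=> /right_inverse_unit[-> uA] /right_inverse_unit[-> uB].
move=> /right_inverse_unit[-> uC] /right_inverse_unit[-> uD].
move=> /right_inverse_unit[-> uE] p.
have p1 : E * C^-1 = D^-1 * A * B.
  by apply: (mulrI uD); apply: (mulIr uC); rewrite !mulrA mulrV // mul1r mulrVK // -p.
split=> //.
- by apply: (mulIr uE); rewrite mulrVK // -!mulrA -p !mulrA mulrVK // mulVr // mul1r.
- have uAB : A * B \is a GRing.unit by rewrite unitrMr.
  have := congr1 GRing.inv p.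
  by rewrite (invrM uAB uC) (invrM uA uB) (invrM uD uE) mulrA.
- by rewrite p1 mulrK.
Qed.

Lemma pentagons : [/\ cop1_4 Q Phi * (PhiV \x 1) = cop3_4 Q PhiV * ins1 Phi * cop2_4 Q Phi,
  (Phi \x 1) * cop1_4 Q PhiV = cop2_4 Q PhiV * ins1 PhiV * cop3_4 Q Phi,
  (PhiV \x 1) * cop2_4 Q PhiV * ins1 PhiV = cop1_4 Q PhiV * cop3_4 Q PhiV
 & cop3_4 Q PhiV * ins1 Phi = cop1_4 Q Phi * (PhiV \x 1) * cop2_4 Q PhiV].
Proof.
apply: pentagon_variants (pentagonQ Q).
- by rewrite -ins1M PhiQK ins1_1.
- by rewrite -cop2_4M PhiQK cop2_4_1.
- by rewrite oxM PhiQK mulr1 -one_ox.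
- by rewrite -cop3_4M PhiQK cop3_4_1.
- by rewrite -cop1_4M PhiQK cop1_4_1.
Qed.

Definition eps1 (t : H3) : H2 := \ts_(a, b, c <- t) eps a *: (b \x c).
Definition eps2 (t : H3) : H2 := \ts_(a, b, c <- t) eps b *: (a \x c).
Definition eps3 (t : H3) : H2 := \ts_(a, b, c <- t) eps c *: (a \x b).

Lemma eps1M (s t : H3) : eps1 (s * t) = eps1 s * eps1 t.
Proof. by rewrite /eps1; pures. Qed.
Lemma eps2M (s t : H3) : eps2 (s * t) = eps2 s * eps2 t.
Proof. by rewrite /eps2; pures. Qed.
Lemma eps3M (s t : H3) : eps3 (s * t) = eps3 s * eps3 t.
Proof. by rewrite /eps3; pures. Qed.
Lemma eps1_1 : eps1 1 = 1. Proof. by rewrite /eps1; pures; rewrite scale1r -!one_ox. Qed.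
Lemma eps2_1 : eps2 1 = 1. Proof. by rewrite /eps2; pures; rewrite scale1r -!one_ox. Qed.
Lemma eps3_1 : eps3 1 = 1. Proof. by rewrite /eps3; pures; rewrite scale1r -!one_ox. Qed.

Definition ins1_3 (t : H2) : H3 := \ts_(a, b <- t) 1 \x a \x b.

(** Applying eps to the second factor of the pentagon leaves
    (1 \ox eps1(Phi)) Phi = Phi, and Phi is invertible. *)
Lemma eps_Phi1 : eps1 Phi = 1.
Proof.
pose k (t : H4) : H3 := \ts_(a, b, c, d <- t) eps b *: (a \x c \x d).
have kM (s t : H4) : k (s * t) = k s * k t by rewrite /k; pures.
have k1 (t : H3) : k (ins1 t) = ins1_3 (eps1 t) by rewrite /k /ins1 /eps1 /ins1_3; pures.
have k2 (t : H3) : k (cop2_4 Q t) = t.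
  rewrite /k /cop2_4; purify t; purify u; pure1; pure1.
  by rewrite -{2}(epsQ_l Q v0); pures.
have k3 : forall x : H3, k (x \x 1) = eps2 x \x 1 by move=> x; rewrite /k /eps2; pures.
have k4 (t : H3) : k (cop3_4 Q t) = cop2 Q (eps2 t) by rewrite /k /eps2 /cop3_4 /cop2;
  pures.
have k5 (t : H3) : k (cop1_4 Q t) = t.
  rewrite /k /cop1_4; purify t; purify u; pure1; pure1.
  by rewrite -{2}(epsQ_r Q u0); pures.
have eA := @epsQ_Phi2 _ _ Q; rewrite -/(eps2 Phi) in eA.
have := congr1 k (pentagonQ Q); rewrite !kM k1 k2 k3 k4 k5 eA -one_ox mulr1 /cop2.
rewrite ts_one ts_ox; [|by lin|by lin]; rewrite copQ1 ts_one ts_ox; [|by lin|by lin].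
rewrite -!one_ox => /(congr1 (fun x => x * PhiV)); rewrite -!mulrA PhiQK !mulr1.
move/(congr1 eps1); rewrite eps1_1 => <-.
by rewrite /eps1 /ins1_3; move: (\ts_(a, b, c <- Phi) _) => T; pures; rewrite scale1r.
Qed.

(** The same with eps on the third factor. *)
Lemma eps_Phi3 : eps3 Phi = 1.
Proof.
pose k (t : H4) : H3 := \ts_(a, b, c, d <- t) eps c *: (a \x b \x d).
have kM (s t : H4) : k (s * t) = k s * k t by rewrite /k; pures.
have k1 (t : H3) : k (ins1 t) = ins1_3 (eps2 t) by rewrite /k /ins1 /eps2 /ins1_3; pures.
have k2 (t : H3) : k (cop2_4 Q t) = t.
  rewrite /k /cop2_4; purify t; purify u; pure1; pure1.
  by rewrite -{2}(epsQ_r Q v0); pures.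
have k3 (t : H3) : k (t \x 1) = eps3 t \x 1 by rewrite /k /eps3; pures.
have k4 (t : H3) : k (cop3_4 Q t) = t.
  rewrite /k /cop3_4; purify t; purify u; pure1; pure1.
  by rewrite -{2}(epsQ_l Q v); pures.
have k5 (t : H3) : k (cop1_4 Q t) = cop1 Q (eps2 t) by rewrite /k /eps2 /cop1_4 /cop1;
  pures.
have eA := @epsQ_Phi2 _ _ Q; rewrite -/(eps2 Phi) in eA.
have := congr1 k (pentagonQ Q); rewrite !kM k1 k2 k3 k4 k5 eA /cop1 /ins1_3.
rewrite ts_one ts_ox; [|by lin|by lin]; rewrite ts_one ts_ox; [|by lin|by lin].
rewrite copQ1 -!one_ox !mul1r mulr1 => /(congr1 (fun x => PhiV * x)).
rewrite mulrA PhiVQK mul1r => /(congr1 eps3); rewrite eps3_1 => <-.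
rewrite /eps3; move: (\ts_(a, b, c <- Phi) _) => T; by pures; rewrite scale1r.
Qed.

Lemma eps_PhiV : [/\ eps1 PhiV = 1, eps2 PhiV = 1 & eps3 PhiV = 1].
Proof.
have eA := @epsQ_Phi2 _ _ Q; rewrite -/(eps2 Phi) in eA; split.
- by rewrite -[LHS]mul1r -{1}eps_Phi1 -eps1M PhiQK eps1_1.
- by rewrite -[LHS]mul1r -{1}eA -eps2M PhiQK eps2_1.
- by rewrite -[LHS]mul1r -{1}eps_Phi3 -eps3M PhiQK eps3_1.
Qed.

(** * The elements p_R and q_R *)

Lemma antipode_alpha_contr (X : falgType K) (G : H -> X) h : islin G ->
  \ts_(a, b <- Delta h) G (S a * alpha * b) = eps h *: G alpha.
Proof.
by move=> hG; rewrite -(islinZ _ _ hG) -antiQ_alpha (islin_ts _ _ hG).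
Qed.
Lemma antipode_beta_contr (X : falgType K) (G : H -> X) h : islin G ->
  \ts_(a, b <- Delta h) G (a * beta * S b) = eps h *: G beta.
Proof.
by move=> hG; rewrite -(islinZ _ _ hG) -antiQ_beta (islin_ts _ _ hG).
Qed.

(** The contractions that make p_R out of the inverse associator and, out of the
    associator, the element q1 \ox S(q2), which involves no inverse of S. *)
Definition fold_beta (T : H3) : H2 := \ts_(a, b, c <- T) a \x (b * beta * S c).
Definition fold_alpha (T : H3) : H2 := \ts_(a, b, c <- T) a \x (S b * alpha * c).
Definition pR := fold_beta PhiV.
Definition sqR := fold_alpha Phi.

(** Quasi-coassociativity moves the coproduct of h across the associator, and
    the part that meets beta disappears. *)
Lemma cop_pR h : \ts_(h1, h2 <- Delta h) (Delta h1 * pR * (1 \x S h2)) = pR * (h \x 1).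
Proof.
have -> : forall D : H2, \ts_(h1, h2 <- D) (Delta h1 * pR * (1 \x S h2)) =
  fold_beta (cop1 Q D * PhiV).
  by move=> D; rewrite /pR /fold_beta /cop1; move: PhiV => T; pures.
have -> : cop1 Q (Delta h) * PhiV = PhiV * cop2 Q (Delta h).
  by rewrite -[LHS]mul1r -{1}(PhiVQK Q) -mulrA (mulrA Phi) -coassQ -!mulrA PhiQK mulr1.
have -> : forall T, fold_beta (T * cop2 Q (Delta h)) =
  fold_beta T * ((\ts_(a, b <- Delta h) (eps b *: a)) \x 1).
  move: (Delta h) => D T; rewrite /fold_beta /cop2.
  purify D; purify T; purify u0; pure1; pure1.
  by contract_by antipode_beta_contr (fun x : H => u1 * u \x (v1 * x * S v0)) v.
by rewrite epsQ_r.
Qed.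

Lemma fold_alpha_cop2 (D : H2) T :
  fold_alpha (cop2 Q D * T) = ((\ts_(a, b <- D) (eps b *: a)) \x 1) * fold_alpha T.
Proof.
rewrite /fold_alpha /cop2.
purify D; purify T; purify u0; pure1; pure1.
by contract_by antipode_alpha_contr (fun x : H => u * u1 \x (S v1 * x * v0)) v.
Qed.

(** The counterpart of cop_pR for q_R, with S applied to its second factor. *)
Lemma sqR_cop h :
  \ts_(a, b <- Delta h) \ts_(a1, a2 <- Delta a) \ts_(k1, k2 <- sqR)
    (k1 * a1 \x (S a2 * k2 * b))
  = (h \x 1) * sqR.
Proof.
have -> : forall D : H2, \ts_(a, b <- D) \ts_(a1, a2 <- Delta a) \ts_(k1, k2 <- sqR)
  (k1 * a1 \x (S a2 * k2 * b)) = fold_alpha (Phi * cop1 Q D).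
  by move=> D; rewrite /sqR /fold_alpha /cop1; move: Phi => T; pures.
by rewrite -coassQ fold_alpha_cop2 epsQ_r.
Qed.

(** The left side is a contraction of the part (Delta \ox id \ox id)(Phi)
    (Phi^-1 \ox 1) of the pentagon.  In the other three factors the coproducts
    meet beta or alpha and vanish, and the axiom for beta and alpha with Phi
    remains. *)
Lemma cop_sqR_pR : \ts_(k1, k2 <- sqR) (Delta k1 * pR * (1 \x k2)) = 1.
Proof.
pose G (N : H4) : H2 := \ts_(a, b, c, d <- N) a \x (b * beta * S c * alpha * d).
have -> : \ts_(k1, k2 <- sqR) (Delta k1 * pR * (1 \x k2)) = G (cop1_4 Q Phi * (PhiV \x 1)).
  rewrite /sqR /pR /G /fold_alpha /fold_beta /cop1_4; move: PhiV => T; move: Phi => T';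
    by pures.
have [-> _ _ _] := pentagons.
have -> : forall N T, G (N * cop2_4 Q T) = G (N * (\ts_(a, c <- eps2 T) a \x 1 \x 1 \x c)).
  move=> N T; rewrite /G /cop2_4 /eps2.
  purify T; purify u; purify N; purify u1; purify u2; pure1; pure1; pure1; pure1.
  by contract_by antipode_beta_contr (fun x : H =>
    (u3 * u0 \x (v3 * x * S v2 * alpha * v1 * v))) v0.
rewrite -/(eps2 Phi) [eps2 _](epsQ_Phi2 Q).
rewrite ts_one ts_ox; [|by lin|by lin]; rewrite -!one_ox mulr1.
have -> : forall N T, G (cop3_4 Q T * N) = eps3 T * G N.
  move=> N T; rewrite /G /cop3_4 /eps3.
  purify T; purify u; purify N; purify u1; purify u2; pure1; pure1; pure1; pure1.
  by contract_by antipode_alpha_contr (fun x : H =>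
    (u0 * u3 \x (v0 * v3 * beta * S v2 * x * v1))) v.
have [_ _ ->] := eps_PhiV.
rewrite mul1r.
have -> : forall T, G (ins1 T) = 1 \x (\ts_(a, b, c <- T) a * beta * S b * alpha * c).
  by move=> T; rewrite /G /ins1; pures.
by rewrite antiQ_Phi -one_ox.
Qed.

(** The mirror image of cop_sqR_pR, by the axiom for alpha and beta with the
    inverse associator. *)
Lemma sqR_cop_pR : \ts_(k1, k2 <- sqR) \ts_(p1, p2 <- pR) \ts_(p11, p12 <- Delta p1)
  (k1 * p11 \x S p12 * k2 * p2) = 1.
Proof.
pose G (N : H4) : H2 := \ts_(a, b, c, d <- N) a \x (S b * alpha * c * beta * S d).
have -> : \ts_(k1, k2 <- sqR) \ts_(p1, p2 <- pR) \ts_(p11, p12 <- Delta p1)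
  (k1 * p11 \x (S p12 * k2 * p2)) = G ((Phi \x 1) * cop1_4 Q PhiV).
  rewrite /sqR /pR /G /fold_alpha /fold_beta /cop1_4; move: PhiV => T; move: Phi => T';
    by pures.
have [_ -> _ _] := pentagons.
have -> : forall N T, G (N * cop3_4 Q T) = G (N * (eps3 T \x 1 \x 1)).
  move=> N T; rewrite /G /cop3_4 /eps3.
  purify T; purify u; purify N; purify u1; purify u2; pure1; pure1; pure1; pure1.
  by contract_by antipode_beta_contr (fun x : H =>
    (u3 * u0 \x (S v0 * S v3 * alpha * v2 * x * S v1))) v.
rewrite eps_Phi3 -!one_ox mulr1.
have -> : forall N T, G (cop2_4 Q T * N) = G ((\ts_(a, c <- eps2 T) a \x 1 \x 1 \x c) * N).
  move=> N T; rewrite /G /cop2_4 /eps2.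
  purify T; purify u; purify N; purify u1; purify u2; pure1; pure1; pure1; pure1.
  by contract_by antipode_alpha_contr (fun x : H =>
    (u0 * u3 \x (S v3 * x * v2 * beta * S v1 * S v))) v0.
have [_ -> _] := eps_PhiV.
rewrite ts_one ts_ox; [|by lin|by lin]; rewrite -!one_ox mul1r.
have -> : forall T, G (ins1 T) = 1 \x (\ts_(a, b, c <- T) S a * alpha * b * beta * S c).
  by move=> T; rewrite /G /ins1; pures.
by rewrite antiQ_PhiV -one_ox.
Qed.

(** * The Drinfeld twist is invertible *)

Definition SSop (T : H2) : H2 := \ts_(a, b <- T) S b \x S a.
Definition gamma_of (N : H4) : H2 := \ts_(a, b, c, d <- N) (S b * alpha * c \x S a *
  alpha * d).
Definition delta_of (N : H4) : H2 := \ts_(a, b, c, d <- N) (a * beta * S d \x b * beta *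
  S c).
Definition gammaT : H2 := gamma_of ((Phi \x 1) * cop1_4 Q PhiV).
Definition deltaT : H2 := delta_of (cop1_4 Q Phi * (PhiV \x 1)).
(** The twist and its inverse, the first one with p_R already collected. *)
Definition twistT : H2 := \ts_(p1, p2 <- pR) SSop (Delta p1) * gammaT * Delta p2.
Definition twistVT : H2 :=
  \ts_(x1, x2, x3 <- PhiV) Delta (S x1 * alpha * x2) * deltaT * SSop (Delta x3).

Lemma gamma_of_cop2 (E : H2) v (N : H4) :
  gamma_of ((cop2 Q E \x v) * N) = gamma_of (((\ts_(a, b <- E) eps b *: a)
    \x 1 \x 1 \x v) * N).
Proof.
rewrite /gamma_of /cop2; purify E; purify N; purify u0; purify u1; do 3 pure1.
by contract_by antipode_alpha_contr (fun x : H =>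
  S v3 * x * v2 \x S (u * u2) * alpha * v * v1) v0.
Qed.

(** In gamma the inner pair of factors, the second and third, is contracted
    first: coproducts nested in the order h1 \ox (h2 \ox h3) \ox h4 vanish from
    the inside. *)
Lemma gamma_of_cop h (N : H4) :
  gamma_of ((\ts_(a, b <- Delta h) cop2 Q (Delta a) \x b) * N) = eps h *: gamma_of N.
Proof.
have -> : gamma_of ((\ts_(a, b <- Delta h) cop2 Q (Delta a) \x b) * N) =
  gamma_of ((\ts_(a, b <- Delta h) a \x 1 \x 1 \x b) * N).
  have lg : islin gamma_of by rewrite /gamma_of; lin.
  have lc : islin (cop2 Q) by rewrite /cop2; lin.
  move: (Delta h) => D; purify D; do 2 pure1.
  by rewrite gamma_of_cop2 epsQ_r.
rewrite /gamma_of; purify N; purify u; purify u0; do 3 pure1.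
by contract_by antipode_alpha_contr (fun x : H => S v1 * alpha * v0 \x S u1 * x * v) h.
Qed.

(** gamma plays the role of alpha for the algebra map Delta and the
    anti-morphism (S \ox S) Delta^op. *)
Lemma gammaT_cop h : \ts_(a, b <- Delta h) SSop (Delta a) * gammaT * Delta b =
  eps h *: gammaT.
Proof.
rewrite /gammaT -gamma_of_cop.
have -> : forall (D : H2) (N : H4), \ts_(a, b <- D) SSop (Delta a) * gamma_of N *
  Delta b = gamma_of (N * cop1_4 Q (cop2 Q D)).
  by move=> D N; rewrite /SSop /gamma_of /cop2 /cop1_4; pures.
rewrite -mulrA -cop1_4M.
have -> : PhiV * cop2 Q (Delta h) = cop1 Q (Delta h) * PhiV.
  by rewrite -[LHS]mulr1 -(PhiQK Q) mulrA -(mulrA PhiV) coassQ mulrA PhiVQK mul1r.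
rewrite cop1_4M !mulrA; congr (gamma_of (_ * _)).
have -> : cop1_4 Q (cop1 Q (Delta h)) = \ts_(a, b <- Delta h) cop1 Q (Delta a) \x b.
  by move: (Delta h) => D; rewrite /cop1 /cop1_4; pures.
rewrite (islin_ts _ _ (G := fun x => (Phi \x 1) * x)); last by lin.
rewrite (islin_ts _ _ (G := fun x => x * (Phi \x 1))); last by lin.
by apply: ts_ext => a b; rewrite !oxM mul1r mulr1 coassQ.
Qed.

Lemma gammaT_cop_map (p : H2) h k :
  \ts_(a, b <- Delta h * p * (1 \x k)) SSop (Delta a) * gammaT * Delta b
  = eps h *: ((\ts_(p1, p2 <- p) SSop (Delta p1) * gammaT * Delta p2) * Delta k).
Proof.
purify p; rewrite [in RHS]ts_ox; [|by rewrite /SSop; lin|by rewrite /SSop; lin].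
transitivity (SSop (Delta u) * (\ts_(a, b <- Delta h) SSop (Delta a) * gammaT * Delta b)
  * Delta v * Delta k).
  by rewrite /SSop; move: gammaT (Delta h) => g D; pures.
by rewrite gammaT_cop -scalerAr -!scalerAl.
Qed.

Lemma SSopM (x y : H2) : SSop (x * y) = SSop y * SSop x.
Proof. by rewrite /SSop; pures. Qed.

(** As for the Drinfeld element below: f = S2(p1) gamma Delta(p2) compares two
    antipodes for the algebra map Delta, where S2 = (S \ox S) Delta^op.
    cop_sqR_pR shows that f carries Delta(alpha) to gamma, and cop_pR that it
    intertwines Delta S with S2. *)
Lemma twistT_alpha : twistT * Delta alpha = gammaT.
Proof.
have lS : islin SSop by rewrite /SSop; lin.
pose V (T : H2) := \ts_(a, b <- T) SSop (Delta a) * gammaT * Delta b.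
have <- : V 1 = gammaT.
  rewrite /V ts_one ts_ox; [|by lin|by lin].
  have -> : SSop (Delta 1) = 1 by rewrite /SSop copQ1; pures; rewrite -one_ox.
  by rewrite copQ1 mul1r mulr1.
have lV : islin V by rewrite /V; lin.
rewrite -cop_sqR_pR (islin_ts _ _ lV); rewrite /V.
under ts_ext => k1 k2 do rewrite gammaT_cop_map -/twistT.
have <- : \ts_(b, c <- eps1 Phi) S b * alpha * c = alpha by rewrite eps_Phi1; pures.
by rewrite /sqR /fold_alpha /eps1; move: twistT Phi => w T; pures.
Qed.

Lemma twistT_S h : twistT * Delta (S h) = SSop (Delta h) * twistT.
Proof.
have lS : islin SSop by rewrite /SSop; lin.
pose V (T : H2) := \ts_(a, b <- T) SSop (Delta a) * gammaT * Delta b.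
have lV : islin V by rewrite /V; lin.
transitivity (V (pR * (h \x 1))).
  rewrite -cop_pR (islin_ts _ _ lV); rewrite /V.
  under ts_ext => k1 k2 do rewrite gammaT_cop_map -/twistT.
  rewrite -{1}(epsQ_l Q h); move: twistT (Delta h) => w D; by pures.
rewrite /V /twistT; move: gammaT pR => g p; purify p.
rewrite oxM mulr1 !ts_ox; [|by lin..].
by rewrite copQM SSopM !mulrA.
Qed.

(** The composite of gamma and delta, seen as evaluation and coevaluation of a
    tensor product of two modules; it has to be straightened. *)
Definition twist_core : H2 := \ts_(x1, x2, x3 <- PhiV) SSop (Delta x1) * gammaT *
  Delta x2 * deltaT * SSop (Delta x3).

Lemma twistT_twistVT_core : twistT * twistVT = twist_core.
Proof.
have lw : islin (fun x : H2 => twistT * x) by lin.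
rewrite /twistVT /twist_core; apply: eq_trans (islin_ts _ _ lw) _.
apply: ts_ext => p x3; apply: eq_trans (islin_ts _ _ lw) _.
by apply: ts_ext => x1 x2; rewrite !copQM !mulrA twistT_S -(mulrA _ twistT) twistT_alpha.
Qed.

(** By the pentagon; the factor in which a coproduct meets beta is trivial. *)
Lemma deltaT_alt : deltaT = delta_of (cop3_4 Q PhiV * ins1 Phi).
Proof.
rewrite /deltaT; have [-> _ _ _] := pentagons.
have -> : forall (N : H4) T, delta_of (N * cop2_4 Q T) =
  delta_of (N * (\ts_(a, c <- eps2 T) a \x 1 \x 1 \x c)).
  move=> N T; rewrite /delta_of /cop2_4 /eps2; purify T; purify u; purify N; purify u1;
    purify u2; do 4 pure1.
  by contract_by antipode_beta_contr (fun x : H =>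
    u3 * u0 * beta * S (v1 * v) \x v3 * x * S v2) v0.
rewrite [eps2 Phi](epsQ_Phi2 Q).
by rewrite ts_one ts_ox; [|by lin|by lin]; rewrite -!one_ox mulr1.
Qed.

(** The contraction of four tensor factors by which gamma and delta enter the
    product; their own associators are kept as sqR and as the last sum. *)
Definition contrT (N : H4) : H2 := \ts_(a, b, c, d <- N) \ts_(k1, k2 <- sqR) \ts_(a1,
  a2 <- Delta a)
  \ts_(d1, d2 <- Delta d) \ts_(X1, X2, X3 <- Phi)
  (S a2 * k2 * b * beta * S (d2 * X3) \x S (k1 * a1) * alpha * c * X1 * beta * S (d1 * X2)).

Lemma twist_core_contrT : twist_core = contrT ((PhiV \x 1) * cop2_4 Q PhiV * ins1 PhiV).
Proof.
rewrite /twist_core deltaT_alt /gammaT /contrT /sqR.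
have E : forall (x y z k X : H3), \ts_(x1, x2, x3 <- y) SSop (Delta x1) *
  gamma_of ((k \x 1) * cop1_4 Q x)
     * Delta x2 * delta_of (cop3_4 Q z * ins1 X) * SSop (Delta x3) =
  \ts_(a, b, c, d <- (x \x 1) * cop2_4 Q y * ins1 z) \ts_(k1, k2 <- fold_alpha k)
    \ts_(a1, a2 <- Delta a)
  \ts_(d1, d2 <- Delta d) \ts_(X1, X2, X3 <- X)
  (S a2 * k2 * b * beta * S (d2 * X3) \x S (k1 * a1) * alpha * c * X1 * beta * S (d1 * X2)).
  move=> x y z k X; rewrite /SSop /gamma_of /delta_of /cop1_4 /cop2_4 /cop3_4 /ins1 /fold_alpha.
  by pures.
exact: E.
Qed.

Definition contrT1 (x : H3) (N : H4) : H2 := \ts_(x1, x2, x3 <- x) \ts_(a, b, c, d <- N)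
  \ts_(k1, k2 <- sqR) \ts_(a1, a2 <- Delta a)
  \ts_(d1, d2 <- Delta (x3 * d)) \ts_(X1, X2, X3 <- Phi)
  (S a2 * k2 * b * beta * S (d2 * X3) \x S (x1 * k1 * a1) * alpha * x2 * c * X1 * beta *
    S (d1 * X2)).

(** The inner antipode is straightened by sqR_cop: of the coproduct of the first
    factor of x only the factor itself is left. *)
Lemma contrT_cop1_4 (x : H3) (N : H4) : contrT (cop1_4 Q x * N) = contrT1 x N.
Proof.
rewrite /contrT /contrT1 /cop1_4; purify x; purify u; purify N; purify u1; purify u2;
  do 5 pure1.
pose G (T : H2) : H2 := \ts_(k1, k2 <- T) \ts_(a1, a2 <- Delta u3)
  \ts_(d1, d2 <- Delta (v * v1)) \ts_(X1, X2, X3 <- Phi)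
  (S a2 * k2 * v3 * beta * S (d2 * X3) \x S (k1 * a1) * alpha * v0 * v2 * X1 * beta *
    S (d1 * X2)).
have := congr1 G (sqR_cop u0); rewrite /G => e.
refine (eq_trans (eq_trans _ e) _); move: sqR Phi => k X; by pures.
Qed.

(** Here the coproduct of the third factor of y is moved across Phi by
    quasi-coassociativity and absorbed by beta. *)
Lemma contrT1_cop3_4 (x y : H3) : contrT1 x (cop3_4 Q y) =
  \ts_(x1, x2, x3 <- x) \ts_(a, b, c <- y) \ts_(k1, k2 <- sqR) \ts_(a1, a2 <- Delta a)
  \ts_(d1, d2 <- Delta x3) \ts_(X1, X2, X3 <- Phi)
  (S a2 * k2 * b * beta * S (d2 * X3 * c) \x S (x1 * k1 * a1) * alpha * x2 * X1 * beta *
    S (d1 * X2)).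
Proof.
rewrite /contrT1 /cop3_4; purify x; purify u; purify y; purify u1; do 4 pure1.
pose G (T : H3) : H2 := \ts_(X1, X2, X3 <- T) \ts_(k1, k2 <- sqR) \ts_(a1, a2 <- Delta u2)
  \ts_(d1, d2 <- Delta v)
  (S a2 * k2 * v2 * beta * S (d2 * X3) \x S (u0 * k1 * a1) * alpha * v0 * X1 * beta *
    S (d1 * X2)).
have e : G (cop2 Q (Delta v1) * Phi) = G (Phi * ((1 \x 1) \x v1)).
  rewrite coassQ -{2}(epsQ_l Q v1).
  have E (N : H3) (D : H2) : G (N * cop1 Q D) =
    G (N * (1 \x 1 \x (\ts_(a, b <- D) eps a *: b))).
    rewrite /G /cop1; purify D; purify N; purify u4; do 2 pure1.
    move: sqR (Delta u2) (Delta v) => k D1 D2; purify k; purify D1; purify D2; do 3 pure1.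
    by contract_by antipode_beta_contr (fun x : H =>
      S v7 * v6 * v2 * beta * S (v8 * (v4 * v3)) \x S (u0 * u6 * u7) * alpha * v0 * u5 *
        x * S (u8 * v5)) u3.
  exact: E.
refine (eq_trans (eq_trans _ e) _).
  by rewrite /G /cop2; move: sqR Phi => k X; pures.
by rewrite /G; move: sqR Phi => k X; pures.
Qed.

(** What remains for the outer antipode once the inner one has been
    straightened; one more pentagon. *)
Lemma straighten : \ts_(x1, x2, x3 <- PhiV) \ts_(d1, d2 <- Delta x3) \ts_(X1, X2, X3 <- Phi)
   (S (d2 * X3) \x S x1 * alpha * x2 * X1 * beta * S (d1 * X2)) = 1.
Proof.
pose G (N : H4) : H2 := \ts_(a, b, c, d <- N) S d \x (S a * alpha * b * beta * S c).
have -> : \ts_(x1, x2, x3 <- PhiV) \ts_(d1, d2 <- Delta x3) \ts_(X1, X2, X3 <- Phi)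
   (S (d2 * X3) \x S x1 * alpha * x2 * X1 * beta * S (d1 * X2)) =
     G (cop3_4 Q PhiV * ins1 Phi).
  by rewrite /G /cop3_4 /ins1; move: PhiV Phi => x X; pures.
have [_ _ _ ->] := pentagons.
have -> : forall (N : H4) T, G (N * cop2_4 Q T) =
  G (N * (\ts_(a, c <- eps2 T) a \x 1 \x 1 \x c)).
  move=> N T; rewrite /G /cop2_4 /eps2; purify T; purify u; purify N; purify u1;
    purify u2; do 4 pure1.
  by contract_by antipode_beta_contr (fun x : H =>
    S (v1 * v) \x S (u3 * u0) * alpha * v3 * x * S v2) v0.
have [_ -> _] := eps_PhiV.
rewrite ts_one ts_ox; [|by lin|by lin]; rewrite -!one_ox mulr1.
have -> : forall (N : H4) T, G (cop1_4 Q T * N) =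
  G ((\ts_(b, c <- eps1 T) 1 \x 1 \x b \x c) * N).
  move=> N T; rewrite /G /cop1_4 /eps1; purify T; purify u; purify N; purify u1;
    purify u2; do 4 pure1.
  by contract_by antipode_alpha_contr (fun x : H =>
    S (v * v1) \x S u3 * x * v3 * beta * S (v0 * v2)) u0.
rewrite eps_Phi1.
rewrite ts_one ts_ox; [|by lin|by lin]; rewrite -!one_ox mul1r.
have -> : forall T : H3, G (T \x 1) = 1 \x (\ts_(a, b, c <- T) S a * alpha * b * beta *
  S c).
  by move=> T; rewrite /G; pures.
by rewrite antiQ_PhiV -one_ox.
Qed.

Lemma twistT_twistVT : twistT * twistVT = 1.
Proof.
rewrite twistT_twistVT_core twist_core_contrT; have [_ _ -> _] := pentagons.
rewrite contrT_cop1_4 contrT1_cop3_4.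
pose G (T : H2) : H2 := \ts_(k1, k2 <- T) \ts_(x1, x2, x3 <- PhiV) \ts_(d1,
  d2 <- Delta x3) \ts_(X1, X2, X3 <- Phi)
   (k2 * S (d2 * X3) \x S (x1 * k1) * alpha * x2 * X1 * beta * S (d1 * X2)).
transitivity (G 1).
  rewrite -sqR_cop_pR /pR /fold_beta /G.
  have E : forall (x y : H3) k (X : H3), \ts_(x1, x2, x3 <- x) \ts_(a, b, c <- y)
    \ts_(k1, k2 <- k) \ts_(a1, a2 <- Delta a)
    \ts_(d1, d2 <- Delta x3) \ts_(X1, X2, X3 <- X)
  (S a2 * k2 * b * beta * S (d2 * X3 * c) \x S (x1 * k1 * a1) * alpha * x2 * X1 * beta *
    S (d1 * X2))
  = \ts_(k1, k2 <- \ts_(k1, k2 <- k) \ts_(p1, p2 <- \ts_(a, b, c <- y) a \x (b * beta *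
    S c)) \ts_(p11, p12 <- Delta p1)
      (k1 * p11 \x S p12 * k2 * p2)) \ts_(x1, x2, x3 <- x) \ts_(d1, d2 <- Delta x3)
        \ts_(X1, X2, X3 <- X)
   (k2 * S (d2 * X3) \x S (x1 * k1) * alpha * x2 * X1 * beta * S (d1 * X2)).
   by move=> x y k X; pures.
  exact: E.
apply: eq_trans straighten; rewrite /G; move: PhiV Phi => x X; by pures.
Qed.

(** * The Drinfeld element and the antipode *)

Section Braiding.
Variables (R : H2) (hR : quasitriangular Q R).

Definition flip_cap (T : H2) : H := \ts_(a, b <- T) S b * alpha * a.
Definition capR : H := flip_cap R.
Definition uR : H := \ts_(r1, r2 <- R) \ts_(p1, p2 <- pR) S (r2 * p2) * alpha * r1 * p1.

(** The evaluation composed with the braiding is again invariant, because R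
    turns the coproduct into its opposite. *)
Lemma capR_cop h : \ts_(h1, h2 <- Delta h) S h2 * capR * h1 = eps h *: capR.
Proof.
have -> : forall D, \ts_(h1, h2 <- D) S h2 * capR * h1 = flip_cap (R * D).
  by move=> D; rewrite /capR /flip_cap; move: R => T; pures.
rewrite -cop_op_R // /capR; move: R => T; rewrite /flip_cap /flip; purify T.
by contract_by antipode_alpha_contr (fun x : H => S v * x * u) h.
Qed.

Lemma uRE : uR = \ts_(p1, p2 <- pR) S p2 * capR * p1.
Proof. by rewrite /uR /capR /flip_cap; move: R => T; move: pR => T'; pures. Qed.

Lemma capR_cop_map (p : H2) h :
  \ts_(a, b <- Delta h * p) S b * capR * a = eps h *: \ts_(p1, p2 <- p) S p2 * capR * p1.
Proof.
purify p; pure1; rewrite [RHS]scalerAl [X in _ = X * _]scalerAr -capR_cop.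
by move: capR (Delta h) => w D; pures.
Qed.

(** By cop_pR and the invariance of capR. *)
Lemma uR_S2 h : uR * h = S (S h) * uR.
Proof.
have -> : uR * h = \ts_(a, b <- pR * (h \x 1)) S b * capR * a.
  by rewrite uRE; move: capR pR => w p; pures.
rewrite -cop_pR.
have -> : forall D : H2, \ts_(a, b <- \ts_(h1, h2 <- D) (Delta h1 * pR * (1 \x S h2)))
  S b * capR * a
  = \ts_(h1, h2 <- D) S (S h2) * \ts_(a, b <- Delta h1 * pR) S b * capR * a.
  by move: capR pR => w p D; pures.
under ts_ext => h1 h2 do rewrite capR_cop_map -uRE.
rewrite -{2}(epsQ_l Q h).
by move: uR (Delta h) => w D; pures.
Qed.

(** By cop_sqR_pR, which cancels p_R. *)
Lemma S_alpha_uR : S alpha * uR = capR.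
Proof.
have <- : \ts_(a, b <- 1) S b * capR * a = capR by pures.
rewrite -cop_sqR_pR.
have -> : forall D : H2, \ts_(a, b <- \ts_(h1, h2 <- D) (Delta h1 * pR * (1 \x h2)))
  S b * capR * a
  = \ts_(h1, h2 <- D) S h2 * \ts_(a, b <- Delta h1 * pR) S b * capR * a.
  by move: capR pR => w p D; pures.
under ts_ext => h1 h2 do rewrite capR_cop_map -uRE.
have <- : \ts_(b, c <- eps1 Phi) S b * alpha * c = alpha by rewrite eps_Phi1; pures.
by rewrite /sqR /fold_alpha /eps1; move: uR Phi => w T; pures.
Qed.

(** The inverse of the Drinfeld element, written with R itself. *)
Definition vR : H := \ts_(X1, X2, X3 <- Phi) \ts_(r1, r2 <- R) \ts_(p1, p2 <- pR)
  X1 * r2 * p2 * S (S (X2 * r1 * p1) * alpha * X3).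

(** Moving u to the left through the antipodes produces a second copy of R; the
    two copies and their associators are those of the hexagon for
    (id \ox Delta)(R), and its coproduct is absorbed by beta. *)
Lemma vR_uR : vR * uR = 1.
Proof.
have -> : vR * uR = \ts_(X1, X2, X3 <- Phi) \ts_(r1, r2 <- R) \ts_(p1, p2 <- pR)
   X1 * r2 * p2 * S X3 * capR * X2 * r1 * p1.
  transitivity (\ts_(X1, X2, X3 <- Phi) \ts_(r1, r2 <- R) \ts_(p1, p2 <- pR)
     X1 * r2 * p2 * S (S (X2 * r1 * p1) * alpha * X3) * uR).
    by rewrite /vR; move: uR pR R Phi => w p T T'; pures.
  apply: ts_ext => p X3; apply: ts_ext => X1 X2; apply: ts_ext => r1 r2; apply: ts_ext =>
    p1 p2.
  by rewrite 2!antiQM -!mulrA -uR_S2 (mulrA (S alpha)) S_alpha_uR !mulrA.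
pose G (N : H3) : H := \ts_(a, b, c <- N) b * beta * S c * alpha * a.
have -> : \ts_(X1, X2, X3 <- Phi) \ts_(r1, r2 <- R) \ts_(p1, p2 <- pR)
   X1 * r2 * p2 * S X3 * capR * X2 * r1 * p1 = G (l13 R * p213 Phi * l12 R * PhiV).
  have E : forall (R1 R2 : H2) (X x : H3), \ts_(X1, X2, X3 <- X) \ts_(r1, r2 <- R1)
    \ts_(p1, p2 <- fold_beta x)
     X1 * r2 * p2 * S X3 * flip_cap R2 * X2 * r1 * p1 = G (l13 R2 * p213 X * l12 R1 * x).
    by move=> R1 R2 X x; rewrite /fold_beta /flip_cap /G /l13 /l12 /p213; pures.
  exact: E.
have -> : l13 R * p213 Phi * l12 R * PhiV = p231 Phi * cop2 Q R.
  have e : p231 Phi * p231 PhiV = 1.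
    have <- : forall s t : H3, p231 (s * t) = p231 s * p231 t by move=> s t;
      rewrite /p231; pures.
    by rewrite PhiQK /p231; pures; rewrite -!one_ox.
  by rewrite hexagon2 // !mulrA e mul1r.
have -> : forall T, G (p231 T * cop2 Q R) = G (p231 T * ((\ts_(a, b <- R) eps b *: a)
  \x 1 \x 1)).
  move=> T; move: R => r; rewrite /G /p231 /cop2; purify r; purify T; purify u0; do 3 pure1.
  by contract_by antipode_beta_contr (fun x : H => (u1 * x * S v1 * alpha * v0 * u)) v.
rewrite (epsQ_R_r hR) -!one_ox mulr1.
by rewrite -[RHS](antiQ_Phi Q) /G /p231; move: Phi => T; pures.
Qed.

Lemma uR_unit : uR \is a GRing.unit.
Proof. by have [-> u] := right_inverse_unit vR_uR; rewrite unitrV. Qed.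

Lemma antipode_inj : injective S.
Proof.
move=> x y e; apply: (mulrI uR_unit); by rewrite !uR_S2 e.
Qed.

Definition cup (T : H2) : H := \ts_(a, b <- T) a * beta * S b.
Definition cupR : H := cup R.

(** The second formula for u, in which the braiding meets the coevaluation.
    A coproduct of R can be inserted in front of alpha without changing the first
    formula.  Its expansion by one hexagon produces, together with the copy of R
    already present, the right hand side of the other hexagon, including the
    associators; this coproduct is then absorbed by beta. *)
Lemma uR_sqR : uR = \ts_(k1, k2 <- sqR) S (S k1) * S cupR * k2.
Proof.
pose F (N : H3) : H := \ts_(a, b, c <- N) S (S c) * S beta * S b * alpha * a.
pose p321 (T : H3) : H3 := \ts_(a, b, c <- T) c \x b \x a.
have p213M (s t : H3) : p213 (s * t) = p213 s * p213 t by rewrite /p213; pures.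
have hexR : p213 (cop1 Q R) = p321 Phi * l23 R * p231 PhiV * l13 R * p213 Phi.
  have e1 (X : H3) : p213 (p312 X) = p321 X by rewrite /p213 /p312 /p321; pures.
  have e2 (r : H2) : p213 (l13 r) = l23 r by rewrite /p213 /l13 /l23; pures.
  have e3 (X : H3) : p213 (p132 X) = p231 X by rewrite /p213 /p132 /p231; pures.
  have e4 (r : H2) : p213 (l23 r) = l13 r by rewrite /p213 /l13 /l23; pures.
  by rewrite (hexagon1 hR) !p213M e1 e2 e3 e4.
have -> : uR = F (l12 R * PhiV).
  by rewrite /uR /pR /F /fold_beta /l12; move: R PhiV => r T; pures.
(* p213 exchanges the first two factors, as the evaluation alpha sees them in
   the opposite order. *)
have <- : F (p213 (cop1 Q R) * (l12 R * PhiV)) = F (l12 R * PhiV).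
  have E : forall N, F (p213 (cop1 Q R) * N) =
    F ((1 \x 1 \x (\ts_(a, b <- R) eps a *: b)) * N).
    move=> N; move: R => r; rewrite /F /p213 /cop1; purify r; purify N; purify u0;
      do 3 pure1.
    by contract_by antipode_alpha_contr (fun x : H =>
      S (S (v * v0)) * S beta * S v1 * x * u1) u.
  by rewrite E (epsQ_R_l hR) -!one_ox mul1r.
have -> : p213 (cop1 Q R) * (l12 R * PhiV) = p321 Phi * l23 R * cop2 Q R.
  by rewrite hexR (hexagon2 hR) !mulrA.
have -> : F (p321 Phi * l23 R * cop2 Q R) = F (p321 Phi * l23 R).
  have E : forall N, F (N * cop2 Q R) = F (N * ((\ts_(a, b <- R) eps b *: a) \x 1 \x 1)).
    move=> N; move: R => r; rewrite /F /cop2; purify r; purify N; purify u0; do 3 pure1.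
    by contract_by antipode_beta_contr (fun x : H =>
      S (S v0) * S x * S v1 * alpha * u1 * u) v.
  by rewrite E (epsQ_R_r hR) -!one_ox mulr1.
by rewrite /cupR /cup /F /p321 /sqR /fold_alpha /l23; move: R Phi => r T; pures.
Qed.

Lemma cupR_cop h : \ts_(h1, h2 <- Delta h) h2 * cupR * S h1 = eps h *: cupR.
Proof.
have -> : forall D, \ts_(h1, h2 <- D) h2 * cupR * S h1 = cup (flip D * R).
  by move=> D; rewrite /cupR /cup /flip; move: R => T; pures.
rewrite (cop_op_R hR) /cupR; move: R => T; rewrite /cup; purify T.
by contract_by antipode_beta_contr (fun x : H => u * x * S v) h.
Qed.

(** By sqR_cop_pR, which cancels q_R in uR_sqR. *)
Lemma S_cupR : S cupR = uR * beta.
Proof.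
have <- : \ts_(a, b <- 1) S (S a) * S cupR * b = S cupR by pures.
rewrite -sqR_cop_pR.
transitivity (\ts_(k1, k2 <- sqR) \ts_(p1, p2 <- pR)
    S (S k1) * S (\ts_(h1, h2 <- Delta p1) h2 * cupR * S h1) * k2 * p2).
  by move: cupR sqR pR => w k p; pures.
under ts_ext => k1 k2 do under ts_ext => p1 p2 do rewrite cupR_cop antiQZ.
have <- : \ts_(b, c <- eps1 PhiV) b * beta * S c = beta.
  by have [-> _ _] := eps_PhiV; pures.
by rewrite uR_sqR /pR /fold_beta /eps1; move: cupR sqR PhiV => w k T; pures.
Qed.

Lemma antipode_surj h : exists g, h = S g.
Proof.
pose f : 'End(H) := linfun (antipode Q).
have fE x : f x = S x by rewrite lfunE.
have kf : lker f == 0%VS by apply/lker0P => x y; rewrite !fE; apply: antipode_inj.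
by exists (f^-1%VF h); rewrite -fE lker0_lfunVK.
Qed.

Let uU : uR \is a GRing.unit := uR_unit.
Let uI h : uR * h = S (S h) * uR := uR_S2 h.

Lemma S2_uR : S (S uR) = uR.
Proof. by apply: (mulIr uU); rewrite -uI. Qed.

Definition zR : H := uR * S uR.

Lemma S_uR_uR : S uR * uR = zR.
Proof. by rewrite /zR uI S2_uR. Qed.

Lemma zR_central h : zR * h = h * zR.
Proof.
have [g1 ->] := antipode_surj h; have [g ->] := antipode_surj g1.
have [g' ->] := antipode_surj g.
rewrite /zR -!mulrA -(antiQM Q (S (S g'))) -uI antiQM !mulrA uI.
by [].
Qed.

Lemma S_zR : S zR = zR.
Proof. by rewrite /zR antiQM S2_uR. Qed.

Lemma zR_unit : zR \is a GRing.unit.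
Proof.
rewrite /zR unitrMr //.
have e : S uR^-1 * S uR = 1 by rewrite -antiQM mulrV // antiQ1.
by have [-> h] := right_inverse_unit e; rewrite unitrV.
Qed.

(** * The monodromy *)

Definition monod : H2 := flip R * R.

Lemma monod_cop h : monod * Delta h = Delta h * monod.
Proof.
have flipM (s t : H2) : flip (s * t) = flip s * flip t by rewrite /flip; pures.
have flipK (s : H2) : flip (flip s) = s by rewrite /flip; pures.
by rewrite /monod -mulrA -(cop_op_R hR) mulrA -flipM -(cop_op_R hR) flipM flipK mulrA.
Qed.

(** S^2 of both sides is computed with S_cupR, S being injective. *)
Lemma cup_monod : cup monod = beta * zR.
Proof.
apply: antipode_inj; apply: antipode_inj.
have -> : cup monod = \ts_(a, b <- R) b * cupR * S a.
  have E : forall r r' : H2, cup (flip r * r') = \ts_(a, b <- r) b * cup r' * S a.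
    by move=> r r'; rewrite /cup /flip; pures.
  exact: E.
have -> : S (\ts_(a, b <- R) b * cupR * S a) = \ts_(a, b <- R) S (S a) * S cupR * S b.
  by move: cupR R => w r; pures.
rewrite S_cupR; have -> : \ts_(a, b <- R) S (S a) * (uR * beta) * S b = uR * cupR.
  rewrite (islin_ts _ _ (G := fun x => uR * x)); last by lin.
  by apply: ts_ext => a b; rewrite !mulrA uI.
by rewrite (antiQM Q uR) (antiQM Q beta) S_zR (antiQM Q zR) S_zR S_cupR /zR !mulrA -uI.
Qed.

Lemma cap_monod : \ts_(a, b <- monod) S a * alpha * b = alpha * zR.
Proof.
have -> : \ts_(a, b <- monod) S a * alpha * b = \ts_(a, b <- R) S a * capR * b.
  have E : forall r r' : H2, \ts_(a, b <- flip r * r') S a * alpha * b =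
    \ts_(a, b <- r') S a * flip_cap r * b.
    by move=> r r'; rewrite /flip_cap /flip; pures.
  exact: E.
rewrite -zR_central -S_uR_uR -mulrA uI mulrA -antiQM S_alpha_uR.
transitivity (\ts_(a, b <- R) S (S b * alpha * a) * uR).
  by apply: ts_ext => a b; rewrite -S_alpha_uR !antiQM -!mulrA uI.
by rewrite /capR /flip_cap; move: uR => w; move: R => r; pures.
Qed.

(** * Left integrals *)

Let SSi h : S (Si h) = h. Proof. exact: antiVQK antipode_inj. Qed.
Let SiS h : Si (S h) = h. Proof. by apply: antipode_inj; rewrite SSi. Qed.

Definition qR : H2 := \ts_(a, b, c <- Phi) a \x (Si (alpha * c) * b).
(** Applied to q_R it gives sqR; being injective, it transports the relations of
    sqR to q_R. *)
Definition idS (T : H2) : H2 := \ts_(a, b <- T) a \x S b.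

Lemma idS_inj : injective idS.
Proof.
move=> x y e; suff i T : \ts_(a, b <- idS T) a \x Si b = T by rewrite -(i x) e i.
by rewrite /idS; purify T; pure1; pure1; rewrite SiS.
Qed.

Lemma idS_qR : idS qR = sqR.
Proof.
rewrite /idS /qR /sqR /fold_alpha; move: Phi => T; pures; rewrite SSi.
by rewrite !mulrA.
Qed.

Lemma qR_cop h : \ts_(a, b <- Delta h) (1 \x Si b) * qR * Delta a = (h \x 1) * qR.
Proof.
apply: idS_inj.
have -> : idS ((h \x 1) * qR) = (h \x 1) * idS qR by rewrite /idS; move: qR => q; pures.
rewrite idS_qR -sqR_cop -idS_qR.
have E : forall D : H2, idS (\ts_(a, b <- D) (1 \x Si b) * qR * Delta a) =
  \ts_(a, b <- D) \ts_(a1, a2 <- Delta a) \ts_(k1, k2 <- idS qR) (k1 * a1 \x S a2 * k2 * b).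
  by move=> D; rewrite /idS; move: qR => q; pures; rewrite SSi.
exact: E.
Qed.

Lemma qR_cop_pR : \ts_(p1, p2 <- pR) (1 \x Si p2) * qR * Delta p1 = 1.
Proof.
apply: idS_inj.
have -> : idS 1 = 1 by rewrite /idS; pures; rewrite -one_ox.
rewrite -sqR_cop_pR -idS_qR.
have E : forall D : H2, idS (\ts_(a, b <- D) (1 \x Si b) * qR * Delta a) =
  \ts_(k1, k2 <- idS qR) \ts_(a, b <- D) \ts_(a1, a2 <- Delta a) (k1 * a1 \x S a2 * k2 * b).
  by move=> D; rewrite /idS; move: qR => q; pures; rewrite SSi.
exact: E.
Qed.

Lemma S_uR_qR : \ts_(q1, q2 <- qR) q2 * cupR * S q1 = S uR.
Proof.
apply: antipode_inj; rewrite S2_uR uR_sqR -idS_qR /idS.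
by move: cupR qR => w q; pures.
Qed.

Lemma eps_pR : \ts_(p1, p2 <- pR) eps p1 *: p2 = beta.
Proof.
have <- : \ts_(b, c <- eps1 PhiV) b * beta * S c = beta.
  by have [-> _ _] := eps_PhiV; pures.
by rewrite /pR /fold_beta /eps1; move: PhiV => T; pures.
Qed.

Section Integral.
Variables (t : H) (t0 : t != 0) (ht : forall h, h * t = eps h *: t).
Local Notation Om := (qR * Delta t).

(** qR_cop, where the coproduct of h is absorbed by the left integral. *)
Lemma integral_qR h : (h \x 1) * Om = (1 \x Si h) * Om.
Proof.
rewrite mulrA -qR_cop.
have -> : forall D : H2, (\ts_(a, b <- D) (1 \x Si b) * qR * Delta a) * Delta t =
   \ts_(a, b <- D) (1 \x Si b) * qR * Delta (a * t).
  by move=> D; rewrite (islin_ts _ _ (G := fun x => x * Delta t)); [apply: ts_ext => a b;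
    rewrite copQM !mulrA | lin].
under ts_ext => a b do rewrite ht copQZ.
rewrite -{2}(epsQ_l Q h).
by move: (Delta h) (Delta t) qR => D T q; pures.
Qed.

Lemma integral_qR_S g : (S g \x 1) * Om = (1 \x g) * Om.
Proof. by rewrite integral_qR SiS. Qed.

(** q_R can be inserted at the price of beta, by qR_cop_pR. *)
Lemma cop_integral_qR : Delta t = (beta \x 1) * Om.
Proof.
rewrite integral_qR -[LHS]mul1r -qR_cop_pR.
have -> : forall D : H2, (\ts_(a, b <- D) (1 \x Si b) * qR * Delta a) * Delta t =
   \ts_(a, b <- D) (1 \x Si b) * qR * Delta (a * t).
  by move=> D; rewrite (islin_ts _ _ (G := fun x => x * Delta t)); [apply: ts_ext => a b;
    rewrite copQM !mulrA | lin].
under ts_ext => a b do rewrite ht copQZ.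
rewrite -eps_pR.
by move: (Delta t) qR pR => T q p; pures.
Qed.

(** A multiplication from the left on both factors is collected in the first
    factor. *)
Lemma mul_integral_qR (T : H2) : T * ((beta \x 1) * Om) = (cup T \x 1) * Om.
Proof.
rewrite /cup; purify T.
rewrite mulrA -[(u \x v) * _]/((u \x v) * (beta \x 1)) oxM mulr1.
have -> : (u * beta) \x v = (u * beta \x 1) * (1 \x v) by pures.
by rewrite -mulrA -integral_qR_S mulrA oxM mulr1 ts_ox; lin.
Qed.

Variables (m : H -> K) (mS : isscal m).
Hypotheses (mM : forall a b, m (a * b) = m a * m b) (m1 : m 1 = 1).
Hypothesis hm : forall h, t * h = m h *: t.

Definition ractm (h : H) : H := \ts_(h1, h2 <- Delta h) m h1 *: h2.
Definition m_sqR : H := \ts_(k1, k2 <- sqR) m k1 *: k2.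

(** cop_pR, where the coproduct of h is absorbed by t through the character. *)
Lemma integral_pR h : Delta t * pR * (h \x 1) = Delta t * pR * (1 \x S (ractm h)).
Proof.
rewrite -mulrA -cop_pR.
have -> : forall D : H2, Delta t * (\ts_(h1, h2 <- D) (Delta h1 * pR * (1 \x S h2))) =
   \ts_(h1, h2 <- D) Delta (t * h1) * pR * (1 \x S h2).
  by move=> D; rewrite (islin_ts _ _ (G := fun x => Delta t * x)); [apply: ts_ext => a b;
    rewrite copQM !mulrA | lin].
under ts_ext => a b do rewrite hm copQZ.
by rewrite /ractm; move: (Delta h) (Delta t) pR => D T p; pures.
Qed.

Lemma cop_integral_pR : Delta t = Delta t * pR * (1 \x m_sqR).
Proof.
rewrite -{1}[Delta t]mulr1 -cop_sqR_pR.
have -> : forall D : H2, Delta t * (\ts_(h1, h2 <- D) (Delta h1 * pR * (1 \x h2))) =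
   \ts_(h1, h2 <- D) Delta (t * h1) * pR * (1 \x h2).
  by move=> D; rewrite (islin_ts _ _ (G := fun x => Delta t * x)); [apply: ts_ext => a b;
    rewrite copQM !mulrA | lin].
under ts_ext => a b do rewrite hm copQZ.
by rewrite /m_sqR; move: sqR (Delta t) pR => D T p; pures.
Qed.

(** The factor inside S is moved to the right end by integral_pR, and m(Q1) S(Q2)
    then cancels p_R by cop_integral_pR.  The left side becomes the flip of q_R
    times Delta^op(t) R p_R.  Here R is moved to the other side of the coproduct
    of t, and mul_integral_qR collects it in one factor, where S_uR_qR recognizes
    S(u). *)
Lemma integral_braiding :
  \ts_(Q1, Q2 <- qR) \ts_(q1, q2 <- qR) \ts_(t1, t2 <- Delta t)
   \ts_(p1, p2 <- pR) \ts_(P1, P2 <- pR) \ts_(R1, R2 <- R)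
     m Q1 *: (q2 * t2 * p2 * S (Q2 * ractm (R2 * P2)) * R1 * P1 \x q1 * t1 * p1)
   = \ts_(q1, q2 <- qR) \ts_(t1, t2 <- Delta t) \ts_(p1, p2 <- pR)
       (S uR * q1 * t1 * p1 \x q2 * t2 * p2).
Proof.
have flipM (x y : H2) : flip (x * y) = flip x * flip y by rewrite /flip; pures.
have linract : islin ractm by rewrite /ractm; lin.
have EEq : m_sqR = \ts_(q1, q2 <- qR) m q1 *: S q2.
  by rewrite /m_sqR -idS_qR /idS; move: qR => q; pures.
transitivity (\ts_(P1, P2 <- pR) \ts_(R1, R2 <- R)
   flip (qR * (Delta t * pR * (1 \x S (ractm (R2 * P2)))) * (1 \x m_sqR * R1 * P1))).
  rewrite EEq; move: ractm linract => rc lr.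
  have E : forall q q' T p p' r : H2, \ts_(Q1, Q2 <- q) \ts_(q1, q2 <- q') \ts_(t1, t2 <- T)
   \ts_(p1, p2 <- p) \ts_(P1, P2 <- p') \ts_(R1, R2 <- r)
     m Q1 *: (q2 * t2 * p2 * S (Q2 * rc (R2 * P2)) * R1 * P1 \x q1 * t1 * p1)
    = \ts_(P1, P2 <- p') \ts_(R1, R2 <- r)
     flip (q' * (T * p * (1 \x S (rc (R2 * P2)))) * (1 \x (\ts_(q1, q2 <- q)
       m q1 *: S q2) * R1 * P1)).
    by move=> q q' T p p' r; rewrite /flip; pures.
  exact: E.
transitivity (\ts_(P1, P2 <- pR) \ts_(R1, R2 <- R) flip (qR * Delta t * (R2 * P2 \x R1 *
  P1))).
  apply: ts_ext => P1 P2; apply: ts_ext => R1 R2; rewrite -integral_pR.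
  have e A B : Delta t * pR * (A \x 1) * (1 \x m_sqR * B) = Delta t * (A \x B).
    rewrite -(mulrA (Delta t * pR)).
    have -> : (A \x 1) * (1 \x m_sqR * B) = (1 \x m_sqR) * (A \x B)
      by rewrite !oxM !mulr1 !mul1r.
    by rewrite mulrA -cop_integral_pR.
  by rewrite -[m_sqR * R1 * P1]mulrA -(mulrA qR) e mulrA.
(* Now R is next to Delta^op(t). *)
transitivity (flip qR * (flip (Delta t) * R) * pR).
  have E : forall X r p : H2, \ts_(P1, P2 <- p) \ts_(R1, R2 <- r) flip (X * (R2 *
    P2 \x R1 * P1)) = flip X * r * p.
    by move=> X r p; rewrite /flip; pures.
  by rewrite E flipM !mulrA.
rewrite (cop_op_R hR) mulrA.
have -> : flip qR * R * Delta t = flip qR * R * ((beta \x 1) * Om)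
  by rewrite -cop_integral_qR.
rewrite mul_integral_qR; have -> : cup (flip qR * R) = S uR.
  by rewrite -S_uR_qR /cupR /cup; move: R qR => r q; rewrite /flip; pures.
by move: (S uR) qR (Delta t) pR => x q T p; pures.
Qed.

Lemma zR_comm2 (T : H2) : (1 \x zR) * T = T * (1 \x zR).
Proof. by purify T; rewrite !oxM mul1r mulr1 zR_central. Qed.

(** The monodromy commutes with the coproduct of t; on the left it is collected
    by mul_integral_qR to beta z, and z = S(z) returns to the second factor. *)
Lemma cop_integral_monod : Delta t * monod = Delta t * (1 \x zR).
Proof.
rewrite -monod_cop {1}cop_integral_qR mul_integral_qR cup_monod.
have -> : beta * zR \x (1 : H) = (beta \x 1) * (zR \x 1) by rewrite oxM mulr1.
rewrite -mulrA -{1}S_zR integral_qR_S mulrA.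
by rewrite -zR_comm2 -mulrA -cop_integral_qR zR_comm2.
Qed.

(** * The distinguished character is transparent *)

Definition contr3 (Y : H3) : H2 := \ts_(a, b, c <- Y) m a *: (b \x c).
Definition contr2 (Y : H2) : H := \ts_(a, b <- Y) m a *: b.
Definition monodm : H := contr2 monod.

Lemma contr3M (s t' : H3) : contr3 (s * t') = contr3 s * contr3 t'.
Proof. by rewrite /contr3; pures; rewrite mM. Qed.
Lemma contr2M (s t' : H2) : contr2 (s * t') = contr2 s * contr2 t'.
Proof. by rewrite /contr2; pures; rewrite mM. Qed.
Lemma contr3_1 : contr3 1 = 1.
Proof. by rewrite /contr3; pures; rewrite m1 scale1r -one_ox. Qed.
Lemma contr2_1 : contr2 1 = 1.
Proof. by rewrite /contr2; pures; rewrite m1 scale1r. Qed.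

Lemma contr2_fold_alpha (Y : H3) : contr2 (fold_alpha Y) =
  \ts_(a, b <- contr3 Y) S a * alpha * b.
Proof. by rewrite /contr2 /contr3 /fold_alpha; pures. Qed.

(** The contraction S(y2) alpha y3 after one more coproduct removes the second
    factor of the coproduct of t, so that t itself can be split off. *)
Lemma contr_integral (D : H2) : t \x contr2 (fold_alpha (Phi * cop1 Q D)) =
  fold_alpha (Phi * cop1 Q (Delta t * D)).
Proof.
rewrite cop1M mulrA -coassQ -mulrA fold_alpha_cop2 epsQ_r.
move: (fold_alpha _) => T; rewrite /contr2; purify T.
by rewrite oxM hm; pures.
Qed.

Lemma contr_zR : contr2 (fold_alpha (Phi * cop1 Q (1 \x zR))) = m_sqR * zR.
Proof.
by rewrite /m_sqR /sqR /contr2; move: zR Phi => x T; rewrite /fold_alpha /cop1; pures.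
Qed.

(** The two hexagons, one of them rotated; the outer associators cancel and the
    two inner copies of R form a monodromy. *)
Lemma Phi_cop1_monod : Phi * cop1 Q monod =
  l23 (flip R) * p132 Phi * l13 monod * p132 PhiV * l23 R * Phi.
Proof.
have p312M (x y : H3) : p312 (x * y) = p312 x * p312 y by rewrite /p312; pures.
have l13M (x y : H2) : l13 (x * y) = l13 x * l13 y by rewrite /l13; pures.
have e0 (x : H2) : cop1 Q (flip x) = p312 (cop2 Q x) by rewrite /cop1 /flip /p312 /cop2;
  pures.
have e1 (X : H3) : p312 (p231 X) = X by rewrite /p312 /p231; pures.
have e2 (r : H2) : p312 (l13 r) = l23 (flip r) by rewrite /p312 /l13 /l23 /flip; pures.
have e3 (X : H3) : p312 (p213 X) = p132 X by rewrite /p312 /p213 /p132; pures.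
have e4 (r : H2) : p312 (l12 r) = l13 (flip r) by rewrite /p312 /l12 /l13 /flip; pures.
have e5 : p312 PhiV * p312 Phi = 1.
  by rewrite -p312M PhiVQK /p312; pures; rewrite -!one_ox.
have e6 (a b c d e : H3) : p312 (a * b * c * d * e) =
  p312 a * p312 b * p312 c * p312 d * p312 e.
  by rewrite !p312M.
have -> : cop1 Q monod = p312 (cop2 Q R) * cop1 Q R by rewrite /monod cop1M e0.
have -> : l13 monod = l13 (flip R) * l13 R by rewrite -l13M.
rewrite (hexagon2 hR) (hexagon1 hR) e6 e1 e2 e3 e4.
move: (p312 PhiV) (p312 Phi) e5 (l23 _) (l23 _) (l13 _) (l13 _) (p132 _) (p132 _) =>
  a b ab c d e f g h.
by rewrite !mulrA PhiQK mul1r -(mulrA _ a) ab mulr1.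
Qed.

Lemma mZ k x : m (k *: x) = k * m x.
Proof.
have m0 : m 0 = 0.
  have := mS 1 0 0; rewrite scaler0 addr0 mul1r => /eqP.
  by rewrite -{1}[m 0]addr0 (inj_eq (addrI _)) => /eqP.
by rewrite -[k *: x]addr0 mS m0 addr0.
Qed.

(** m(beta) divides m(1), by the axiom for beta and alpha with Phi. *)
Lemma m_beta : m beta != 0.
Proof.
apply/eqP => b0.
pose psi (x : H) : H := m x *: 1; have lpsi : islin psi by rewrite /psi; lin.
have : psi 1 = 0.
  rewrite -(antiQ_Phi Q) (islin_ts _ _ lpsi).
  apply: ts_eq0 => p c; rewrite (islin_ts _ _ lpsi).
  by apply: ts_eq0 => a b; rewrite /psi !mM b0 mulr0 !mul0r scale0r.
by rewrite /psi m1 scale1r => /eqP; rewrite oner_eq0.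
Qed.

(** h can be recovered: composing with m S on the first factor inverts the
    character up to m(beta). *)
Lemma ractm_inj : injective ractm.
Proof.
have E h : contr3 PhiV * Delta (ractm h) * contr3 Phi = \ts_(a, b <- Delta h) ractm a \x b.
  have -> : Delta (ractm h) = contr3 (cop2 Q (Delta h)).
    by rewrite /ractm /contr3 /cop2; move: (Delta h) => D; pures.
  rewrite -!contr3M -mulrA coassQ mulrA PhiVQK mul1r /contr3 /cop1 /ractm.
  by move: (Delta h) => D; pures.
pose L (T : H2) : H := \ts_(c, b <- T) m (beta * S c) *: b.
have F h : m beta *: h = L (\ts_(a, b <- Delta h) ractm a \x b).
  have lL : islin L by rewrite /L; lin.
  rewrite (islin_ts _ _ lL).
  transitivity (m beta *: \ts_(a, b <- Delta h) eps a *: b); first by rewrite epsQ_l.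
  have lG : islin (fun x : H => m beta *: x) by lin.
  apply: eq_trans (islin_ts _ _ lG) _.
  apply: ts_ext => a b; rewrite /L ts_ox; [|by lin|by lin].
  have lp : islin (fun x : H => m x *: b) by lin.
  transitivity (m (\ts_(x, y <- Delta a) x * beta * S y) *: b).
    by rewrite antiQ_beta mZ mulrC scalerA.
  apply: eq_trans (islin_ts _ _ lp) _.
  have lq : islin (fun x : H => m (beta * S x) *: b) by lin.
  apply: eq_trans _ (esym (islin_ts _ _ lq)).
  by apply: ts_ext => x y; rewrite (islinZ _ _ lq) scalerA -mM mulrA.
move=> x y e; have := F x; rewrite -E e E -F.
by move/(scalerI m_beta).
Qed.

Lemma ractm_surj h : exists g, h = ractm g.
Proof.
have linract : islin ractm by rewrite /ractm; lin.
pose g : {linear H -> H} := HB.pack ractm (GRing.isLinear.Build _ _ _ _ _ linract).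
have fE x : linfun g x = ractm x by rewrite lfunE.
have kf : lker (linfun g) == 0%VS by apply/lker0P => x y; rewrite !fE; apply: ractm_inj.
by exists ((linfun g)^-1%VF h); rewrite -fE lker0_lfunVK.
Qed.

(** It commutes with all h <- m, because the monodromy commutes with
    coproducts. *)
Lemma monodm_central h : monodm * h = h * monodm.
Proof.
have [g ->] := ractm_surj h.
have -> : ractm g = contr2 (Delta g) by [].
by rewrite /monodm -!contr2M monod_cop.
Qed.

(** m is multiplicative, so that the inner monodromy becomes a central element,
    the associators around it cancel, and the outer copies of R form a
    monodromy again, to which cap_monod applies. *)
Lemma contr_monod : contr2 (fold_alpha (Phi * cop1 Q monod)) = m_sqR * zR * monodm.
Proof.
move: cap_monod zR_central; move: zR => x cap xc.
rewrite contr2_fold_alpha Phi_cop1_monod !contr3M.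
have -> : contr3 (l13 monod) = 1 \x monodm.
  by rewrite /monodm /contr2 /contr3 /l13; move: monod => c; pures.
have mc (T : H2) : T * (1 \x monodm) = (1 \x monodm) * T.
  by move: monodm monodm_central => w wc; purify T; rewrite !oxM !mul1r !mulr1 wc.
have M23 r : contr3 (l23 r) = r.
  by rewrite /contr3 /l23; pures; rewrite m1 scale1r.
have XY : contr3 (p132 Phi) * contr3 (p132 PhiV) = 1.
  have e (X Y : H3) : p132 (X * Y) = p132 X * p132 Y by rewrite /p132; pures.
  by rewrite -contr3M -e PhiQK /p132; pures; rewrite -!one_ox contr3_1.
rewrite !M23 mc -!mulrA (mulrA (contr3 (p132 Phi))) XY mul1r (mulrA (flip R)) -/monod -mc.
have -> : \ts_(a, b <- monod * contr3 Phi * (1 \x monodm)) S a * alpha * b =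
   (\ts_(a, b <- contr3 Phi) S a * (\ts_(c, d <- monod) S c * alpha * d) * b) * monodm.
  by move: monod monodm (contr3 Phi) => c w T; pures.
have -> : m_sqR = contr2 (fold_alpha Phi) by [].
rewrite cap contr2_fold_alpha.
move: (contr3 Phi) => T; purify T; pures.
by rewrite -(mulrA _ x) xc !mulrA.
Qed.

(** Applying m to the first factor of sqR_cop_pR gives 1 = S(p1 <- m) E p2 for
    E = m_sqR. *)
Lemma m_sqR_cancel n : (forall h, n * h = h * n) -> m_sqR * n = 0 -> n = 0.
Proof.
move=> nc En; rewrite -[LHS]mul1r -contr2_1 -sqR_cop_pR.
have -> : contr2 (\ts_(k1, k2 <- sqR) \ts_(p1, p2 <- pR) \ts_(p11, p12 <- Delta p1)
   (k1 * p11 \x S p12 * k2 * p2)) = \ts_(p1, p2 <- pR) S (ractm p1) * m_sqR * p2.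
  have E (k p : H2) : contr2 (\ts_(k1, k2 <- k) \ts_(p1, p2 <- p) \ts_(p11, p12 <- Delta p1)
    (k1 * p11 \x S p12 * k2 * p2)) = \ts_(p1, p2 <- p) S (ractm p1) * (\ts_(k1, k2 <- k)
      m k1 *: k2) * p2.
    by rewrite /contr2 /ractm; pures; rewrite mM mulrC.
  exact: E.
rewrite (islin_ts _ _ (G := fun x => x * n)); last by lin.
by apply: ts_eq0 => a b; rewrite -!mulrA -nc (mulrA m_sqR) En mul0r mulr0.
Qed.

(** Delta(t) C = Delta(t)(1 \ox z) is contracted: the left side gives E z monodm,
    the right side E z, where E = m_sqR can be cancelled. *)
Theorem monodm_eq1 : monodm = 1.
Proof.
have e : m_sqR * zR * monodm = m_sqR * zR.
  by apply: (ox_inj t0); rewrite -contr_monod -contr_zR !contr_integral cop_integral_monod.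
move: zR_central zR_unit e; move: zR => x xc xu e.
(* z (monodm - 1) is central and annihilated by m_sqR. *)
have n0 : x * (monodm - 1) = 0.
  apply: m_sqR_cancel; last by rewrite mulrA mulrBr mulr1 e subrr.
  have mc h : (monodm - 1) * h = h * (monodm - 1)
    by rewrite mulrBl mulrBr mulr1 mul1r monodm_central.
  by move=> h; rewrite -mulrA mc mulrA xc mulrA.
apply/eqP; rewrite -subr_eq0; apply/eqP; apply: (mulrI xu).
by rewrite n0 mulr0.
Qed.

End Integral.

(** * The map Q at a transparent character *)

Section Factor.

Definition pL : H2 := \ts_(a, b, c <- Phi) b * Si (a * beta) \x c.
Definition eltU : H2 := \ts_(g1, g2 <- twistVT) \ts_(q1, q2 <- qR) g1 * S q2 \x g2 * S q1.
Definition factorm (m : H -> K) : H :=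
  \ts_(X1, X2, X3 <- Phi) \ts_(X21, X22 <- Delta X2)
  \ts_(p1, p2 <- pL) \ts_(f1, f2 <- twistT)
  \ts_(R1, R2 <- R) \ts_(r1, r2 <- R) \ts_(U1, U2 <- eltU)
    m (S (X22 * p2) * f1 * R2 * r1 * U1 * X3)
      *: (X1 * S (X21 * p1) * f2 * R1 * r2 * U2).

Lemma factormZ (m m' : H -> K) k : isscal m -> isscal m' -> (forall x, m' x = k * m x) ->
  factorm m' = k *: factorm m.
Proof.
move=> mS mS' mE; rewrite /factorm.
have E : forall (X : H3) (p f r r' U : H2),
  \ts_(X1, X2, X3 <- X) \ts_(X21, X22 <- Delta X2)
  \ts_(p1, p2 <- p) \ts_(f1, f2 <- f)
  \ts_(R1, R2 <- r) \ts_(r1, r2 <- r') \ts_(U1, U2 <- U)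
    m' (S (X22 * p2) * f1 * R2 * r1 * U1 * X3)
      *: (X1 * S (X21 * p1) * f2 * R1 * r2 * U2)
  = k *: \ts_(X1, X2, X3 <- X) \ts_(X21, X22 <- Delta X2)
  \ts_(p1, p2 <- p) \ts_(f1, f2 <- f)
  \ts_(R1, R2 <- r) \ts_(r1, r2 <- r') \ts_(U1, U2 <- U)
    m (S (X22 * p2) * f1 * R2 * r1 * U1 * X3)
      *: (X1 * S (X21 * p1) * f2 * R1 * r2 * U2).
  by move=> X p f r r' U; pures; rewrite mE.
exact: E.
Qed.

Variables (m : H -> K) (mS : isscal m).
Hypothesis mM : forall a b, m (a * b) = m a * m b.
Hypothesis monodm1 : contr2 m monod = 1.

Definition factor_contr (T : H2) : H := \ts_(X1, X2, X3 <- Phi) \ts_(X21, X22 <- Delta X2)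
  \ts_(p1, p2 <- pL) \ts_(t1, t2 <- T) m (S (X22 * p2) * t1 * X3) *: (X1 * S (X21 * p1) *
    t2).
Definition swap_sqR : H2 := \ts_(k1, k2 <- sqR) k2 \x S k1.

(** m is a character, so that only the image of T under m \ox id matters. *)
Lemma factor_contr_char T : factor_contr T = factor_contr (1 \x contr2 m T).
Proof.
rewrite /factor_contr /contr2; move: Phi pL => X p; purify T; pures.
by rewrite !mM [_ * m u]mulrC !mulrA.
Qed.

Lemma factormE : factorm m = factor_contr (twistT * monod * (twistVT * swap_sqR)).
Proof.
rewrite /factorm /eltU /swap_sqR -idS_qR /monod.
have E : forall (X : H3) (p f r r' g q : H2),
  \ts_(X1, X2, X3 <- X) \ts_(X21, X22 <- Delta X2)
  \ts_(p1, p2 <- p) \ts_(f1, f2 <- f)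
  \ts_(R1, R2 <- r) \ts_(r1, r2 <- r') \ts_(U1, U2 <- \ts_(g1, g2 <- g) \ts_(q1, q2 <- q)
    g1 * S q2 \x g2 * S q1)
    m (S (X22 * p2) * f1 * R2 * r1 * U1 * X3)
      *: (X1 * S (X21 * p1) * f2 * R1 * r2 * U2)
  = \ts_(X1, X2, X3 <- X) \ts_(X21, X22 <- Delta X2)
  \ts_(p1, p2 <- p) \ts_(t1, t2 <- f * (flip r * r') * (g * \ts_(k1, k2 <- idS q)
    k2 \x S k1)) m (S (X22 * p2) * t1 * X3) *: (X1 * S (X21 * p1) * t2).
  by move=> X p f r r' g q; rewrite /idS /flip; pures.
exact: E.
Qed.

(** The three copies of Phi coming from the definition of Q, from p_L and from
    q_R form one side of the pentagon; on the other side every coproduct meets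
    alpha or beta. *)
Lemma factor_contr_sqR : factor_contr swap_sqR = m alpha *: beta.
Proof.
pose G (N : H4) : H := \ts_(a, b, c, d <- N) m (S c * alpha * d) *: (a * beta * S b).
have -> : factor_contr swap_sqR = G (ins1 Phi * cop2_4 Q Phi * (Phi \x 1)).
  rewrite /factor_contr /swap_sqR /sqR /G /pL.
  have E : forall X Y Z : H3, \ts_(X1, X2, X3 <- X) \ts_(X21, X22 <- Delta X2)
    \ts_(p1, p2 <- \ts_(a, b, c <- Y) b * Si (a * beta) \x c)
    \ts_(t1, t2 <- \ts_(k1, k2 <- fold_alpha Z) k2 \x S k1) m (S (X22 * p2) * t1 * X3)
      *: (X1 * S (X21 * p1) * t2)
   = \ts_(a, b, c, d <- ins1 Z * cop2_4 Q X * (Y \x 1)) m (S c * alpha * d) *: (a *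
     beta * S b).
    move=> X Y Z; rewrite /fold_alpha /ins1 /cop2_4; pures.
    by rewrite (antiVQK _ antipode_inj) !mulrA.
  exact: E.
rewrite pentagonQ.
have -> : forall (N : H4) T, G (N * cop1_4 Q T) =
  G (N * (\ts_(b, c <- eps1 T) 1 \x 1 \x b \x c)).
  move=> N T; rewrite /G /cop1_4 /eps1; purify T; purify u; purify N; purify u1;
    purify u2; do 4 pure1.
  by contract_by antipode_beta_contr (fun x : H =>
    m (S (v2 * v0) * alpha * (v1 * v)) *: (u3 * x * S v3)) u0.
rewrite eps_Phi1 ts_one ts_ox; [|by lin|by lin]; rewrite -!one_ox.
have -> : forall (N : H4) T, G (cop3_4 Q T * N) = G ((eps3 T \x 1 \x 1) * N).
  move=> N T; rewrite /G /cop3_4 /eps3; purify T; purify u; purify N; purify u1;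
    purify u2; do 4 pure1.
  by contract_by antipode_alpha_contr (fun x : H =>
    m (S v2 * x * v1) *: (u0 * u3 * beta * S (v0 * v3))) v.
by rewrite eps_Phi3 -!one_ox mul1r /G; pures.
Qed.

(** Under the character the monodromy disappears and the twist cancels against
    its inverse. *)
Lemma factorm_char : factorm m = m alpha *: beta.
Proof.
have mult := contr2M mS mM.
rewrite factormE factor_contr_char mult (mult _ monod)
  monodm1 mulr1 -mult mulrA twistT_twistVT mul1r.
by rewrite -factor_contr_char factor_contr_sqR.
Qed.
End Factor.

(* Unfolding is needed to recognize the map of the definition. *)
Section Bridge.
Transparent tens ox ts copQ antiQ antiVQ alphaQ betaQ epsQ PhiQ PhiVQ.

Lemma factor_mapE (chi : 'Hom(H, K^o)) :
  factor_map Q R chi = factorm (fun x => chi x).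
Proof.
have tE : twist Q = twistT :> H2.
  rewrite /twistT /pR /fold_beta /gammaT.
  have E : forall (x : H3) (g : H2),
      \ts_(p1, p2 <- \ts_(a, b, c <- x) a \x (b * beta * S c))
        SSop (Delta p1) * g * Delta p2
    = \ts_(x1, x2, x3 <- x) SSop (Delta x1) * g * Delta (x2 * beta * S x3).
    by move=> x g; rewrite /SSop; pures.
  by rewrite E.
by rewrite /factor_map tE.
Qed.

Lemma eps_alpha : eps alpha = 1.
Proof. exact: counit_alpha. Qed.

End Bridge.

Lemma contr2_eps_monod : contr2 eps monod = 1.
Proof.
rewrite /monod.
have -> : contr2 eps (flip R * R)
    = (\ts_(a, b <- R) eps b *: a) * (\ts_(a, b <- R) eps a *: b).
  have E : forall r r' : H2, contr2 eps (flip r * r')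
      = (\ts_(a, b <- r) eps b *: a) * (\ts_(a, b <- r') eps a *: b).
    by move=> r r'; have sE := @scal_epsQ _ _ Q; rewrite /contr2 /flip; pures.
  exact: E.
by rewrite (epsQ_R_l hR) (epsQ_R_r hR) mulr1.
Qed.

Lemma linear_form_of (m : H -> K) :
  isscal m -> exists chi : 'Hom(H, K^o), forall x, chi x = m x.
Proof.
move=> mS; pose g : {linear H -> K^o} :=
  HB.pack (m : H -> K^o) (GRing.isLinear.Build K H K^o _ (m : H -> K^o) mS).
by exists (linfun g) => x; rewrite lfunE.
Qed.

Lemma character_eq_counit (m : H -> K) (t : H) :
  factorizable Q R ->
  isscal m -> (forall a b, m (a * b) = m a * m b) -> m 1 = 1 ->
  t != 0 -> (forall h, h * t = eps h *: t) -> (forall h, t * h = m h *: t) ->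
  m =1 eps.
Proof.
move=> [_ [f' fK _]] mS mM m1 t0 ht hm.
have sE := @scal_epsQ _ _ Q.
have [chi chiE] := linear_form_of mS; have [chie chieE] := linear_form_of sE.
have e1 : factor_map Q R chi = m alpha *: beta.
  rewrite factor_mapE -[RHS]scale1r.
  rewrite -(factorm_char mS mM (monodm_eq1 t0 ht mS mM m1 hm)).
  apply: factormZ => // [a x y|x]; first by rewrite linearP.
  by rewrite chiE mul1r.
have e2 : factor_map Q R (m alpha *: chie) = m alpha *: beta.
  rewrite factor_mapE (@factormZ eps _ (m alpha)) //.
  - by rewrite (factorm_char sE (@epsQM _ _ Q) contr2_eps_monod) eps_alpha scale1r.
  - by move=> a x y; rewrite linearP.
  - by move=> x; rewrite scale_lfunE chieE.
have e : chi = m alpha *: chie by rewrite -(fK chi) e1 -e2 fK.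
have mE x : m x = m alpha * eps x by rewrite -chiE e scale_lfunE chieE.
(* Evaluation at 1. *)
have ma : m alpha = 1 by have := mE 1; rewrite m1 epsQ1 mulr1 => <-.
by move=> x; rewrite mE ma mul1r.
Qed.

End Braiding.

End QuasiHopf.

(** * Unimodularity *)

Theorem theorem7p4 (K : fieldType) (H : falgType K) (Q : quasiHopf H)
    (R : tensor H H) (hR : quasitriangular Q R)
    (t : H) (t_neq0 : t != 0) (ht : left_integral Q t)
    (mu : {lrmorphism H -> K | *%R}) (hmu : distinguished_grouplike Q mu) :
  (\tsum_(Q1, Q2 <- elt_qR Q) \tsum_(q1, q2 <- elt_qR Q)
   \tsum_(t1, t2 <- cop Q t)
   \tsum_(p1, p2 <- elt_pR Q) \tsum_(P1, P2 <- elt_pR Q)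
   \tsum_(R1, R2 <- R)
     mu Q1 *: (q2 * t2 * p2 * antipode Q (Q2 * ract Q (R2 * P2) mu) * R1 * P1
               \ox q1 * t1 * p1)
   = \tsum_(q1, q2 <- elt_qR Q) \tsum_(t1, t2 <- cop Q t)
     \tsum_(p1, p2 <- elt_pR Q)
       (antipode Q (elt_u Q R) * q1 * t1 * p1 \ox q2 * t2 * p2))
  /\ (factorizable Q R -> unimodular Q).
Proof.
have mS : isscal mu by exact: scal_lr.
have mM (a b : H) : mu (a * b) = mu a * mu b by rewrite rmorphM.
have m1 : mu 1 = 1 by rewrite rmorph1.
have hm h : t * h = mu h *: t by apply: hmu.
split.
  Transparent tens ox ts copQ antiQ antiVQ alphaQ betaQ epsQ PhiQ PhiVQ.
  exact: (integral_braiding hR ht mS hm).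
move=> hF; have muE := character_eq_counit hR hF mS mM m1 t_neq0 ht hm.
by exists t; split=> // h; rewrite hm muE.
Qed.
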